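(* Let $n,N$ be positive integers with $(n,N)=1$. Then for every $f\in\mathcal{M}(N)$, $$\mathfrak{D}(f|\mathcal{T}(n))=\mathfrak{D}(f)|T_2(n).$$
   Context: Let $q=e^{2\pi i\tau}$. $\mathcal{M}(N)$ denotes the multiplicative group of meromorphic modular forms $f$ on the upper half-plane of some integer weight $k$ for $\Gamma_0(N)$ with some unitary multiplier system (i.e. $f(\gamma\tau)=\chi(\gamma)(c\tau+d)^kf(\tau)$ for $\gamma\in\Gamma_0(N)$, $\chi:\Gamma_0(N)\to S^1$, meromorphic at cusps), with integer Fourier coefficients at $i\infty$ and leading coefficient $1$. With $(f|_k\gamma)(\tau)=\det(\gamma)^{k/2}(c\tau+d)^{-k}f(\gamma\tau)$, for a prime $p\nmid N$, $r\ge1$: $f|\mathcal{T}(p^{r}):=\varepsilon\, p^{\frac{k}{1-p}\left(\frac{p^{r+1}-p}{p-1}-\frac{r}{2}(p^{r+1}+1)\right)}\prod_{ad=p^{r},\,0\le b<d}f|_{k}\begin{psmallmatrix}a&b\\0&d\end{psmallmatrix}$ ($a,d>0$), $\varepsilon$ the constant making the leading coefficient 1; this lies in $\mathcal{M}(N)$ with weight $k\sigma(p^r)$. For $n=\prod p_i^{r_i}$ coprime to $N$, $\mathcal{T}(n)$ is the composition of the $\mathcal{T}(p_i^{r_i})$ (each with the weight of its current argument); $\mathcal{T}(1)$ is the identity. $M_2^{\mathrm{mero}}(N)$ is the space of meromorphic modular forms of weight 2 on $\Gamma_0(N)$. $\Theta=q\,\frac{d}{dq}=\frac{1}{2\pi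 i}\frac{d}{d\tau}$, $E_2(\tau)=1-24\sum_{n\ge1}\sigma(n)q^n$ with $\sigma(n)$ the divisor sum, and for $f\in\mathcal{M}(N)$ of weight $k$, $\mathfrak{D}(f):=\Theta(f)/f-kE_2/12\in M_2^{\mathrm{mero}}(N)$. For $(n,N)=1$ and $g\in M_2^{\mathrm{mero}}(N)$, the additive Hecke operator is $(g|T_2(n))(\tau):=\sum_{ad=n,\,0\le b<d}g|_2\begin{psmallmatrix}a&b\\0&d\end{psmallmatrix}(\tau)=\sum_{ad=n,\,0\le b<d}\frac{n}{d^2}\,g\big(\frac{a\tau+b}{d}\big)$. *)

(* Defs.v *)
From mathcomp Require Import all_boot all_order all_algebra.
From mathcomp Require Import all_classical all_reals all_analysis.
From mathcomp.real_closed Require Import complex.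

Set Implicit Arguments.
Unset Strict Implicit.
Unset Printing Implicit Defensive.

Import Order.TTheory GRing.Theory Num.Theory.
Import numFieldNormedType.Exports.
Local Open Scope classical_set_scope.
Local Open Scope ring_scope.
Local Open Scope complex_scope.

(* Complex numbers are [R[i]] for a [realType] [R].  The topology of [R[i]] is
   available on its copy [R[i]^o] (a normed module over itself). *)

Definition sigma (n : nat) : nat := (\sum_(d <- divisors n) d)%N.

Section ComplexAnalysis.
Variable R : realType.
Implicit Types (F G : R[i] -> R[i]) (z tau : R[i]).

Definition uhp tau : bool := 0 < complex.Im tau.

Definition cexp z : R[i] :=
  (expR (complex.Re z))%:C *
  (cos (complex.Im z) +i* sin (complex.Im z)).

(* q^h = e^(2 pi i h tau), for a real exponent h *)
Definition qpow (h : R) tau : R[i] := cexp ((2 * pi * h)%:C * 'i * tau).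

(* A meromorphic function is represented by a total function whose values at
   its poles carry no meaning.  Equality of meromorphic functions on an open
   set [U] is equality off a discrete closed subset of [U]; equivalently,
   equality on a punctured neighbourhood of every point of [U]. *)
Definition mero_eq (U : set R[i]) F G : Prop :=
  forall z0 : R[i]^o, U z0 -> \forall z \near z0^', F z = G z.

(* Laurent expansion with finite principal part:
   (z - z0)^m F(z) = sum_(j >= 0) c_j (z - z0)^j on a punctured neighbourhood *)
Definition meromorphic_at F (z0 : R[i]^o) : Prop :=
  exists (m : nat) (c : nat -> R[i]), \forall z \near z0^',
    series (fun j => c j * (z - z0) ^+ j : R[i]^o) @ \oo
      --> ((z - z0) ^+ m * F z : R[i]^o).

(* F = q^h sum_(j >= 0) c_j q^(j/w) as meromorphic functions on Im tau > Y, the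
   series being convergent there. *)
Definition fourier_expansion F (h : R) (w : nat) (c : nat -> R[i]) : Prop :=
  exists2 Y : R, 0 < Y &
  exists2 S : R[i] -> R[i],
    (forall tau, Y < complex.Im tau ->
       series (fun j => c j * qpow (j%:R / w%:R) tau : R[i]^o) @ \oo
         --> (S tau : R[i]^o)) &
    mero_eq [set tau | Y < complex.Im tau] F (fun tau => qpow h tau * S tau).

Definition leading_coef F (a : R[i]) : Prop :=
  a != 0 /\ exists (h : R) (c : nat -> R[i]),
    fourier_expansion F h 1 c /\ c 0%N = a.

Definition theta F tau : R[i] :=
  (2 * pi)%:C^-1 / 'i *
  (derive1 (F : R[i]^o -> R[i]^o) (tau : R[i]^o) : R[i]).

Definition E2 tau : R[i] :=
  1 - 24 * (limn (fun m =>
    \sum_(1 <= n < m) (sigma n)%:R * qpow 1 tau ^+ n : R[i]^o) : R[i]).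

Definition moebius (g : 'M[int]_2) tau : R[i] :=
  ((g 0 0)%:~R * tau + (g 0 1)%:~R) / ((g 1 0)%:~R * tau + (g 1 1)%:~R).

Definition slash (k : int) F (g : 'M[int]_2) tau : R[i] :=
  ((\det g)%:~R `^ (k%:~R / 2))%:C *
  ((g 1 0)%:~R * tau + (g 1 1)%:~R) ^ (- k) * F (moebius g tau).

End ComplexAnalysis.

Definition Gamma0 (N : nat) (g : 'M[int]_2) : bool :=
  (\det g == 1) && (N%:Z %| (g 1 0)%R)%Z.

Definition upper_mx (a b d : nat) : 'M[int]_2 :=
  \matrix_(i, j) (nth [::] [:: [:: a%:Z; b%:Z]; [:: 0; d%:Z]] i)`_j.

(* A function on the upper half-plane together with a weight *)
Record wform (R : realType) := WForm { wt : int; fn :> R[i] -> R[i] }.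

Section MultiplicativeForms.
Variable R : realType.
Implicit Types (f : wform R) (F : R[i] -> R[i]).

(* f|_k g is q^h times a power series in q^(1/w) near infinity, for all g in
   SL_2(Z).  The exponent h is real because the multiplier is only assumed
   unitary, so that f|_k g is w-periodic only up to a constant of modulus 1. *)
Definition meromorphic_at_cusps f : Prop :=
  forall g : 'M[int]_2, \det g = 1 ->
    exists (h : R) (w : nat) (c : nat -> R[i]),
      (0 < w)%N /\ fourier_expansion (slash (wt f) f g) h w c.

Definition unitary_modular (N : nat) f : Prop :=
  exists chi : 'M[int]_2 -> R[i],
    forall g, Gamma0 N g -> `|chi g| = 1 /\
      mero_eq [set tau | uhp tau] (fun tau => f (moebius g tau))
        (fun tau => chi g * ((g 1 0)%:~R * tau + (g 1 1)%:~R) ^ wt f * f tau).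

(* Membership in the multiplicative group M(N): the leading coefficient is
   c 0 = 1, and the form is q^h sum_(j >= 0) c_j q^j near infinity, the c_j being
   its integer Fourier coefficients. *)
Definition mult_form (N : nat) f : Prop :=
  [/\ forall tau, uhp tau -> meromorphic_at f tau,
      unitary_modular N f,
      meromorphic_at_cusps f &
      exists (h : R) (c : nat -> int),
        c 0%N = 1 /\ fourier_expansion f h 1 (fun j => (c j)%:~R)].

(* The constant making the leading coefficient of F equal to 1; it is unique
   when it exists, and 1 is a junk value when F has no leading coefficient. *)
Definition lead_normalizer F : R[i] :=
  xget 1 [set e : R[i] | leading_coef (fun tau => e * F tau) 1].

Definition hecke_const (p r : nat) (k : int) : R :=
  let P : R := p%:R in
  P `^ (k%:~R / (1 - P) *
        ((P ^+ r.+1 - P) / (P - 1) - r%:R / 2 * (P ^+ r.+1 + 1))).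

Definition mult_hecke_pp (p r : nat) f : wform R :=
  let F := fun tau => (hecke_const p r (wt f))%:C *
    \prod_(d <- divisors (p ^ r)) \prod_(b < d)
       slash (wt f) f (upper_mx (p ^ r %/ d) b d) tau in
  WForm (wt f * (sigma (p ^ r))%:Z) (fun tau => lead_normalizer F * F tau).

(* T(n): the T(p^r), for p^r exactly dividing n, applied successively *)
Definition mult_hecke (n : nat) f : wform R :=
  foldl (fun g pr => mult_hecke_pp pr.1 pr.2 g) f (prime_decomp n).

Definition Dlog f (tau : R[i]) : R[i] :=
  theta f tau / f tau - (wt f)%:~R * E2 tau / 12.

Definition add_hecke2 (n : nat) F (tau : R[i]) : R[i] :=
  \sum_(d <- divisors n) \sum_(b < d) slash 2 F (upper_mx (n %/ d) b d) tau.

End MultiplicativeForms.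

(* Main.v *)
Require Import Defs.
From mathcomp Require Import all_boot all_order all_algebra.
From mathcomp Require Import all_classical all_reals all_analysis.
From mathcomp.real_closed Require Import complex.
From mathcomp Require Import ring lra.

(** Taking logarithmic derivatives turns the product defining [f | T(p^r)] into
    the sum over the same matrices defining [(Theta f / f) | T_2(p^r)], and the
    correction term is right because [E_2 | T_2(p^r) = sigma(p^r) E_2], which
    comes from comparing q-expansions: [sum_(a | gcd(p^r, k)) a sigma(p^r k / a^2)
    = sigma(p^r) sigma(k)].  Composite [n] follows from
    [T_2(m) T_2(n) = T_2(m n)] for coprime [m], [n] on 1-periodic functions.
    Logarithmic derivatives make sense off a discrete set because [f] does not
    vanish identically near any point: its leading Fourier coefficient is nonzero
    and the upper half-plane is connected. *)

Set Implicit Arguments.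
Unset Strict Implicit.
Unset Printing Implicit Defensive.
Import Order.TTheory GRing.Theory Num.Theory.
Import numFieldNormedType.Exports.

Local Open Scope classical_set_scope.
Local Open Scope ring_scope.
Local Open Scope complex_scope.

(** * Calculus over a numeric field *)

Section NumFieldCalculus.
Context {K : numFieldType}.
Implicit Types (f g : K^o -> K^o) (z : K^o).

(** The termwise identity for logarithmic derivatives makes sense at z only if f is differentiable
    and nonzero at the finitely many points (a z + b) / d. Statements are therefore proved off a
    discrete closed set, a notion stable under finite intersections and affine preimages
    ([near_uhp]). Both differentiability and isolation of zeros are read off from the local power
    series supplied by [meromorphic_at].

    The normaliser, the Hecke constant and the determinant powers cancel in a logarithmic derivative
    as soon as they are nonzero. The only trace of the normalisation is the weight, which is
    multiplied by sigma(p^r) and so matches the eigenvalue of E_2. That eigenvalue is computed on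
    truncations whose lengths are matched, so that only finite sums are rearranged.

    The induction over the prime powers of n carries regularity of the intermediate form.
    Periodicity is asked of [Dlog f] alone: f(z + 1) = chi f(z) with chi of modulus 1, and chi
    cancels. It serves to reduce the upper right entries of products of coset representatives. *)

Lemma cvg_mull (u : nat -> K^o) (l : K^o) (h : K) : u @ \oo --> l ->
  (fun n => h * u n : K^o) @ \oo --> (h * l : K^o).
Proof. exact: cvgZl_tmp. Qed.

Lemma regular_hausdorff : hausdorff_space K^o.
Proof. exact: norm_hausdorff. Qed.

Lemma regular_cvg_unique (u : nat -> K^o) (l l' : K^o) :
  u @ \oo --> l -> u @ \oo --> l' -> l = l'.
Proof. exact: (cvg_unique regular_hausdorff). Qed.

Lemma cvg_bigsum (I : eqType) (s : seq I) (u : I -> nat -> K^o) (l : I -> K^o) :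
  (forall i, i \in s -> u i @ \oo --> l i) ->
  (fun n => \sum_(i <- s) u i n : K^o) @ \oo --> (\sum_(i <- s) l i : K^o).
Proof.
elim: s => [_|i s IH us].
  by rewrite big_nil; under eq_fun do rewrite big_nil; exact: cvg_cst.
rewrite big_cons; under eq_fun do rewrite big_cons.
apply: cvgD; first by apply: us; rewrite mem_head.
by apply: IH => j js; apply: us; rewrite in_cons js orbT.
Qed.

Lemma cvg_mul_subseq (u : nat -> K^o) (l : K^o) k : (0 < k)%N ->
  u @ \oo --> l -> (fun n => u (k * n)%N) @ \oo --> l.
Proof.
move=> k0 ul; apply: (@cvg_comp _ _ _ (fun n => (k * n)%N) u _ \oo) => //.
move=> A [N _ NA]; exists N => // n /= Nn; apply: NA => /=.
by rewrite (leq_trans Nn)// leq_pmull.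
Qed.

Lemma derivable_mul f g z : derivable f z 1 -> derivable g z 1 ->
  derivable (fun z => f z * g z : K^o) z 1.
Proof. exact: derivableM. Qed.

Lemma derive1_mul f g z : derivable f z 1 -> derivable g z 1 ->
  derive1 (fun z => f z * g z : K^o) z = derive1 f z * g z + f z * derive1 g z.
Proof.
by move=> f1 g1; rewrite !derive1E deriveM//; rewrite addrC [g z *: _]mulrC.
Qed.

Lemma derivable_inv f z : f z != 0 -> derivable f z 1 ->
  derivable (fun z => (f z)^-1 : K^o) z 1.
Proof. exact: derivableV. Qed.

Lemma derivable_const (k : K) z : derivable (fun=> k : K^o) z 1.
Proof. exact: derivable_cst. Qed.

Lemma derivable_subc (k : K) z : derivable (fun z => z - k : K^o) z 1.
Proof. by apply: derivableB; [exact: derivable_id|exact: derivable_cst]. Qed.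

Lemma derivable_exp f z n : derivable f z 1 ->
  derivable (fun z => f z ^+ n : K^o) z 1.
Proof.
move=> fz; elim: n => [|n IH].
  by under eq_fun do rewrite expr0; exact: derivable_const.
by under eq_fun do rewrite exprS; exact: derivable_mul.
Qed.

Lemma derive1_const (k : K) z : derive1 (fun=> k : K^o) z = 0.
Proof. by rewrite derive1E derive_cst. Qed.

Lemma derive1_mull (k : K) f z : derivable f z 1 ->
  derive1 (fun z : K^o => (k : K) * (f z : K) : K^o) z = k * (derive1 f z : K) :> K.
Proof.
move=> fz; rewrite derive1_mul ?derive1_const ?mul0r ?add0r//; exact: derivable_const.
Qed.

Lemma derivable_near_eq f g z : (\forall w \near z, f w = g w) ->
  derivable f z 1 -> derivable g z 1.
Proof. exact: near_eq_derivable. Qed.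

Lemma derive1_near_eq f g z : (\forall w \near z, f w = g w) ->
  derive1 f z = derive1 g z.
Proof. by move=> fg; rewrite !derive1E; exact: near_eq_derive. Qed.

(** The chain rule is applied to differentials: that of the inner map is multiplication by [a], and
    linearity of the outer one pulls [a] out. *)
Lemma is_derive_affine f (a b : K) z df :
  is_derive (a * z + b : K^o) 1 f df ->
  is_derive z 1 (fun w => f (a * w + b) : K^o) (a * df).
Proof.
move=> [fd <-].
have affd : is_diff z (fun w : K^o => a * w + b : K^o) ( *%R a).
  have -> : (fun w : K^o => a * w + b : K^o) = ( *:%R a + cst b).
    by apply/funext.
  have -> : *%R a = *:%R a + 0 :> (K^o -> K^o) by rewrite addr0.
  exact: is_diffD.
have fdiff : differentiable f (a * z + b : K^o) by exact/derivable1_diffP.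
pose A : K^o -> K^o := fun w => a * w + b.
have affd' : differentiable A z by case: affd.
have dA : 'd A z = *%R a :> (K^o -> K^o) by case: affd.
apply: DeriveDef; first by apply/derivable1_diffP; exact: (@differentiable_comp _ _ _ _ A f).
rewrite (@deriveE _ _ _ (f \o A))//; last exact: differentiable_comp.
rewrite diff_comp// /= dA mulr1 [in RHS]deriveE//.
by rewrite -[X in 'd _ _ X = _](mulr1 a) -[LHS]/('d f (A z) (a *: 1)) linearZ.
Qed.

Lemma derivable_affine f (a b : K) z : derivable f (a * z + b : K^o) 1 ->
  derivable (fun w => f (a * w + b) : K^o) z 1.
Proof. by move=> /derivableP/is_derive_affine[]. Qed.

Lemma derive1_affine f (a b : K) z : derivable f (a * z + b : K^o) 1 ->
  derive1 (fun w : K^o => f (a * (w : K) + b : K) : K^o) z =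
  a * (derive1 f (a * (z : K) + b : K) : K) :> K.
Proof. by move=> /derivableP/is_derive_affine[_ e]; rewrite !derive1E. Qed.

Lemma derivable_prod (I : eqType) (s : seq I) (f : I -> K -> K) (z : K) :
  (forall i, i \in s -> derivable (f i : K^o -> K^o) (z : K^o) 1) ->
  derivable (fun w : K^o => \prod_(i <- s) f i w : K^o) (z : K^o) 1.
Proof.
elim: s => [_|i s IH fd].
  by under eq_fun do rewrite big_nil; exact: derivable_const.
under eq_fun do rewrite big_cons.
apply: derivable_mul; first by apply: fd; rewrite mem_head.
by apply: IH => j js; apply: fd; rewrite in_cons js orbT.
Qed.

Lemma logderive_prod (I : eqType) (s : seq I) (f : I -> K -> K) (z : K) :
    (forall i, i \in s -> derivable (f i : K^o -> K^o) (z : K^o) 1) ->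
    (forall i, i \in s -> f i z != 0) ->
  derive1 (fun w : K^o => \prod_(i <- s) f i w : K^o) (z : K^o) / \prod_(i <- s) f i z =
  \sum_(i <- s) (derive1 (f i : K^o -> K^o) (z : K^o) : K) / f i z.
Proof.
elim: s => [_ _|i s IH fd f0].
  under eq_fun do rewrite big_nil.
  by rewrite derive1_const mul0r big_nil.
have fds j : j \in s -> derivable (f j : K^o -> K^o) (z : K^o) 1.
  by move=> js; apply: fd; rewrite in_cons js orbT.
have f0s j : j \in s -> f j z != 0 by move=> js; apply: f0; rewrite in_cons js orbT.
have fi0 : f i z != 0 by apply: f0; rewrite mem_head.
have p0 : \prod_(j <- s) f j z != 0.
  by rewrite prodf_seq_neq0; apply/allP => j /f0s.
under eq_fun do rewrite big_cons.
rewrite derive1_mul ?big_cons -?IH//; [|by apply: fd; rewrite mem_head|exact: derivable_prod].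
by field; rewrite fi0 p0.
Qed.

End NumFieldCalculus.

(** * Complex series *)

Section PowerSeries.
Context {R : realType}.
Local Notation C := (R[i]^o).
Implicit Types (u : nat -> C) (z l : C).

Lemma ler_complex (a b : R) : ((a%:C : R[i]) <= b%:C) = (a <= b).
Proof. exact: lecR. Qed.

Lemma ltr_complex (a b : R) : ((a%:C : R[i]) < b%:C) = (a < b).
Proof. exact: ltcR. Qed.

Lemma real_complexM (a b : R) : (a * b)%:C = a%:C * b%:C :> R[i].
Proof. exact: rmorphM. Qed.

Lemma real_complexX (a : R) n : (a ^+ n)%:C = a%:C ^+ n :> R[i].
Proof. exact: rmorphXn. Qed.

Lemma real_complexD (a b : R) : (a + b)%:C = a%:C + b%:C :> R[i].
Proof. exact: rmorphD. Qed.

Lemma pos_complexE (e : R[i]) : 0 < e -> exists2 r : R, 0 < r & e = r%:C.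
Proof.
move=> e0; have /complex_realP[r er] : e \is Num.real by rewrite realE ltW.
by exists r; rewrite // -ltr_complex -er.
Qed.

Lemma nneg_complexE (e : R[i]) : 0 <= e -> exists2 r : R, 0 <= r & e = r%:C.
Proof.
move=> e0; have /complex_realP[r er] : e \is Num.real by rewrite realE e0.
by exists r; rewrite // -ler_complex -er.
Qed.

Lemma normc_real (r : R) : `|r%:C : R[i]| = `|r|%:C.
Proof. by rewrite normc_def /= expr0n /= addr0 sqrtr_sqr. Qed.

(** The order of [R[i]] is only partial, so the bound is negated for the real number r with |l| = r
    rather than for |l| itself. *)
Lemma cvg_norm_le u l (B : R) :
  u @ \oo --> l -> (forall n, `|u n| <= B%:C) -> `|l| <= B%:C.
Proof.
move=> ul uB; have [r r0 lr] := nneg_complexE (normr_ge0 (l : R[i])).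
rewrite lr ler_complex leNgt; apply/negP => Br.
have e0 : 0 < (r - B)%:C :> R[i] by rewrite ltr_complex subr_gt0.
have /cvgrPdist_lt/(_ _ e0)[N _ /(_ N (leqnn _)) /= ulN] := ul.
suff : `|l| < `|l| by rewrite ltxx.
rewrite -[X in `|X| < _](subrK (u N)) (le_lt_trans (ler_normD _ _))//.
rewrite [ltRHS]lr; have -> : r%:C = (r - B)%:C + B%:C :> R[i].
  by rewrite -raddfD /= subrK.
exact: ltr_leD.
Qed.

Lemma series_ReIm u n :
  series u n = (series (fun k => complex.Re (u k)) n)%:C +
               'i * (series (fun k => complex.Im (u k)) n)%:C :> R[i].
Proof.
rewrite /series /= !raddf_sum mulr_sumr -big_split /=.
by apply: eq_bigr => k _; rewrite -complexE.
Qed.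

Lemma norm_i : `|'i : R[i]| = 1.
Proof. by rewrite normc_def /= expr0n expr1n add0r sqrtr1. Qed.

Lemma cvg_ReIm (a b : nat -> R) (x y : R) : a @ \oo --> x -> b @ \oo --> y ->
  (fun n => (a n)%:C + 'i * (b n)%:C : C) @ \oo --> (x%:C + 'i * y%:C : C).
Proof.
move=> ax bY; apply/cvgrPdist_lt => _ /pos_complexE[e e0 ->].
have e20 : 0 < e / 2 by rewrite divr_gt0.
near=> n.
have -> : x%:C + 'i * y%:C - ((a n)%:C + 'i * (b n)%:C) =
    (x - a n)%:C + 'i * (y - b n)%:C :> R[i].
  by rewrite !raddfB /= mulrBr opprD addrACA.
rewrite (le_lt_trans (ler_normD _ _))// normrM norm_i mul1r !normc_real.
rewrite -raddfD ltr_complex (splitr e) ltrD//; near: n.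
- by move/cvgrPdist_lt: ax; apply.
- by move/cvgrPdist_lt: bY; apply.
Unshelve. all: by end_near. Qed.

Lemma normc_ge_Im z : `|complex.Im z|%:C <= `|z|.
Proof.
have := normc_ge_Re (z * 'i : R[i]); rewrite ReiNIm normrN normrM norm_i mulr1.
exact.
Qed.

(** Completeness is used over the reals: real and imaginary parts are dominated by the norm, hence
    by a geometric series. *)
Lemma geometric_cvg_series u (M q : R) : 0 <= M -> 0 <= q < 1 ->
  (forall n, `|u n| <= (M * q ^+ n)%:C) -> cvgn (series u).
Proof.
move=> M0 /andP[q0 q1] uM.
have gc : cvgn (series (geometric M q)).
  by apply: is_cvg_geometric_series; rewrite ger0_norm.
have abs_cvg (v : nat -> R) : (forall n, `|v n|%:C <= `|u n|) -> cvgn (series v).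
  move=> vu; apply: normed_cvg; apply: series_le_cvg gc => n //=.
    by rewrite mulr_ge0 // exprn_ge0.
  by rewrite -ler_complex (le_trans (vu n)).
have cr := abs_cvg (fun k => complex.Re (u k)) (fun k => normc_ge_Re _).
have ci := abs_cvg (fun k => complex.Im (u k)) (fun k => normc_ge_Im _).
apply/cvg_ex; exists ((limn (series (fun k => complex.Re (u k))))%:C +
  'i * (limn (series (fun k => complex.Im (u k))))%:C : C).
have := cvg_ReIm cr ci; apply: cvg_trans.
by apply: near_eq_cvg; near=> n; rewrite /= -series_ReIm.
Unshelve. all: by end_near. Qed.

Lemma geometric_series_norm u (M : R) n : 0 <= M ->
  (forall n, `|u n| <= (M * 2^-1 ^+ n)%:C) -> `|series u n| <= (2 * M)%:C.
Proof.
move=> M0 uM; rewrite /series /= (le_trans (ler_norm_sum _ _ _)) //.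
apply: (@le_trans _ _ (\sum_(0 <= k < n) (M * 2^-1 ^+ k))%:C).
  by rewrite raddf_sum; apply: ler_sum => k _; apply: uM.
rewrite ler_complex -mulr_sumr mulrC ler_wpM2r//.
have -> : \sum_(0 <= k < n) 2^-1 ^+ k = 2 - 2 * 2^-1 ^+ n :> R.
  elim: n => [|n IH]; first by rewrite big_geq// expr0 mulr1 subrr.
  rewrite big_nat_recr//= IH exprS mulrA divff ?pnatr_eq0//.
  by rewrite [in X in _ + X](_ : 2^-1 ^+ n = 2 * 2^-1 ^+ n - 2^-1 ^+ n) ?mul1r ?addrA ?subrK//
    mulr2n mulrDl mul1r addrK.
by rewrite gerBl mulr_ge0// exprn_ge0// invr_ge0.
Qed.

End PowerSeries.

(** * Power series *)

Section PowerSeriesLocal.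
Context {R : realType}.
Local Notation C := (R[i]^o).
Implicit Types (u c : nat -> R[i]) (z w l : R[i]).

Lemma pseries_terms_bounded c w : cvgn (series (fun j => c j * w ^+ j : C)) ->
  exists2 M : R, 0 <= M & forall j, `|c j * w ^+ j| <= M%:C.
Proof.
move=> /cvg_series_cvg_0 c0.
have /cvg_seq_bounded/pinfty_ex_gt0[M M0 cM] : cvgn (fun j => c j * w ^+ j : C).
  by apply/cvg_ex; exists 0.
have [r r0 Mr] := pos_complexE M0.
by exists r; rewrite ?ltW// => j; have := cM j I; rewrite Mr.
Qed.

(** Abel's comparison: boundedness of the terms at [w1] gives geometric decay at every w with |w| <=
    t |w1|. *)
Lemma pseries_ratio_bound c w1 w (M t : R) j : w1 != 0 ->
  (forall j, `|c j * w1 ^+ j| <= M%:C) -> `|w| <= t%:C * `|w1| ->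
  `|c j * w ^+ j| <= (M * t ^+ j)%:C.
Proof.
move=> w10 cM wt.
have -> : `|c j * w ^+ j| = `|c j * w1 ^+ j| * (`|w| / `|w1|) ^+ j.
  rewrite !normrM !normrX exprMn exprVn -!mulrA; congr (_ * _).
  by rewrite mulrCA divff ?mulr1// expf_neq0// normr_eq0.
have ratio : `|w| / `|w1| <= t%:C by rewrite ler_pdivrMr ?normr_gt0.
have ratio0 : 0 <= `|w| / `|w1| by rewrite divr_ge0.
by rewrite real_complexM real_complexX ler_pM ?exprn_ge0// lerXn2r ?nnegrE// (le_trans ratio0).
Qed.

(** Close to 0 the tail of the series is smaller than |c_0|, so it cannot cancel the constant
    term. *)
Lemma pseries_neq0 c w1 : w1 != 0 ->
    cvgn (series (fun j => c j * w1 ^+ j : C)) -> c 0%N != 0 ->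
  exists2 r : R, 0 < r & forall w l, `|w| < r%:C ->
    series (fun j => c j * w ^+ j : C) @ \oo --> (l : C) -> l != 0.
Proof.
move=> w10 /pseries_terms_bounded[M M0 cM] c0.
have [k k0 ck] : exists2 k : R, 0 < k & `|c 0%N| = k%:C.
  by apply: pos_complexE; rewrite normr_gt0.
have [s s0 ws] : exists2 s : R, 0 < s & `|w1| = s%:C.
  by apply: pos_complexE; rewrite normr_gt0.
(* With t <= 1/2 the tail is geometric and at most 4 M t. The second bound makes this less than k =
   |c_0|; M + 1 in place of M makes the inequality strict and covers M = 0. *)
pose t := Num.min 2^-1 (k / (4 * (M + 1))).
have M10 : 0 < 4 * (M + 1) by rewrite mulr_gt0// ltr_wpDl.
have t0 : 0 < t by rewrite lt_min invr_gt0 ltr0n/= divr_gt0.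
have t2 : t <= 2^-1 by rewrite ge_min lexx.
have tk : t * (4 * (M + 1)) <= k by rewrite -ler_pdivlMr// ge_min lexx orbT.
exists (t * s) => [|w l wts cl]; first by rewrite mulr_gt0.
have wt : `|w| <= t%:C * `|w1| by rewrite ws -real_complexM ltW.
pose u j : R[i] := if j is 0%N then 0 else c j * w ^+ j.
have uM j : `|u j| <= (2 * M * t * 2^-1 ^+ j)%:C.
  case: j => [|j] /=; first by rewrite normr0 (ler_complex 0) !mulr_ge0// ltW.
  rewrite (le_trans (pseries_ratio_bound j.+1 w10 cM wt))// ler_complex.
  rewrite [2 * M]mulrC -!mulrA ler_wpM2l// exprS mulrCA ler_wpM2l ?(ltW t0)//.
  by rewrite exprS mulrA divff ?pnatr_eq0// mul1r lerXn2r ?nnegrE// ?invr_ge0// ltW.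
(* The index is shifted because the empty partial sum does not yet contain the term c_0 that is
   subtracted. *)
have ul : (fun n => series u n.+1 : C) @ \oo --> (l - c 0%N : C).
  rewrite (_ : (fun n => _) =
    (fun n => series (fun j => c j * w ^+ j : C) n.+1 - c 0%N : C)); last first.
    apply/funext => n; rewrite /series /= !big_nat_recl//= expr0 mulr1 add0r.
    by rewrite addrAC subrr add0r.
  by apply: cvgB; [rewrite (cvg_shiftS (series _))|exact: cvg_cst].
apply/eqP => l0.
have T0 : 0 <= 2 * M * t by rewrite !mulr_ge0// ltW.
have := cvg_norm_le ul (fun n => geometric_series_norm n.+1 T0 uM).
rewrite l0 sub0r normrN ck ler_complex; apply/negP; rewrite -ltNge (lt_le_trans _ tk)//.
rewrite mulrA mulrC ltr_pM2l// mulrA -natrM ltr_pM2l ?ltr0n//.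
by rewrite ltrDl.
Qed.

(* The Taylor remainder [e_j = (w + h)^j - w^j - j w^(j-1) h] satisfies
   [e_(j+1) = (w + h) e_j + j h^2 w^(j-1)]. *)
Lemma expr_taylor_bound (w h : R[i]) (s a : R) j : 0 <= s -> `|w| <= s%:C ->
    `|w + h| <= s%:C -> `|h| ^+ 2 = (a * s ^+ 2)%:C -> 0 <= a ->
  `|(w + h) ^+ j - w ^+ j - j%:R * w ^+ j.-1 * h| <= (a * (2 * s) ^+ j)%:C.
Proof.
move=> s0 ws whs ha a0; elim: j => [|j IH].
  by rewrite !expr0 subrr mul0r mul0r subr0 normr0 mulr1 (ler_complex 0).
have -> : (w + h) ^+ j.+1 - w ^+ j.+1 - j.+1%:R * w ^+ j * h =
  (w + h) * ((w + h) ^+ j - w ^+ j - j%:R * w ^+ j.-1 * h) +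
    j%:R * h ^+ 2 * w ^+ j.-1.
  case: j {IH} => [|j] /=; first by rewrite !expr0 !expr1; ring.
  by rewrite -!natr1 [w ^+ j.+2]exprS [(w + h) ^+ j.+2]exprS [w ^+ j.+1]exprS; ring.
rewrite (le_trans (ler_normD _ _))// [(2 * s) ^+ j.+1]exprS.
have -> : a * (2 * s * (2 * s) ^+ j) =
  s * (a * (2 * s) ^+ j) + s * (a * (2 * s) ^+ j) by ring.
rewrite real_complexD lerD//.
  by rewrite normrM real_complexM ler_pM.
rewrite !normrM !normrX -expr2 ha normr_nat.
case: j {IH} => [|j] /=; first by rewrite !mul0r (ler_complex 0) !mulr_ge0// exprn_ge0// mulr_ge0.
apply: (@le_trans _ _ (j.+1%:R%:C * (a * s ^+ 2)%:C * (s ^+ j)%:C)).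
  rewrite rmorph_nat ler_pM// ?mulr_ge0//; first by rewrite (ler_complex 0) mulr_ge0// exprn_ge0.
  by rewrite real_complexX lerXn2r ?nnegrE// (ler_complex 0).
rewrite -!real_complexM ler_complex.
have -> : s * (a * (2 * s) ^+ j.+1) = 2 ^+ j.+1 * (a * s ^+ 2) * s ^+ j.
  by rewrite exprMn [s ^+ j.+1]exprS; ring.
rewrite -!mulrA ler_wpM2r ?mulr_ge0 ?exprn_ge0//.
by rewrite -natrX ler_nat ltnW// ltn_expl.
Qed.

(** S(w + h) - S(w) - h sum_j D_j is the series of c_j times the Taylor remainder of w^j, and is
    bounded by a constant times |h|^2. Shrinking the disc is harmless, since the lemma serves points
    close to the centre of a Laurent expansion. *)
Lemma pseries_derivable c (S : R[i] -> R[i]) (r : R) : 0 < r ->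
    (forall w, `|w| < r%:C ->
       series (fun j => c j * w ^+ j : C) @ \oo --> (S w : C)) ->
  exists2 d : R, 0 < d & forall w, `|w| < d%:C -> derivable (S : C -> C) (w : C) 1.
Proof.
move=> r0 cS; pose w1 : R[i] := (r / 2)%:C.
have nw1 : `|w1| = (r / 2)%:C :> R[i] by rewrite normc_real ger0_norm// divr_ge0// ltW.
have r20 : 0 < r / 2 by rewrite divr_gt0.
have w10 : w1 != 0 by rewrite -normr_gt0 nw1 (ltr_complex 0).
have [M M0 cM] : exists2 M : R, 0 <= M & forall j, `|c j * w1 ^+ j| <= M%:C.
  apply: pseries_terms_bounded; apply/cvg_ex; exists (S w1); apply: cS.
  by rewrite nw1 ltr_complex ltr_pdivrMr// ltr_pMr// ltr1n.
(* This is a quarter of |w1| = r / 2, so that |c_j| s^j <= M 4^(-j). The factor 2^j in the Taylor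
   bound, or the factor j <= 2^j in D_j, then still leaves the decay 2^(-j). *)
pose s : R := r / 8.
have s0 : 0 < s by rewrite divr_gt0.
exists (s / 2) => [|w ws]; first by rewrite divr_gt0.
have s2s : s / 2 + s / 2 = s by rewrite -splitr.
have ws' : `|w| <= s%:C.
  by rewrite (le_trans (ltW ws))// ler_complex ler_pdivrMr// ler_pMr// ler1n.
pose D j : R[i] := c j * (j%:R * w ^+ j.-1).
have cb j : `|c j| * (s ^+ j)%:C <= (M * 4^-1 ^+ j)%:C.
  have cMj := cM j; rewrite normrM normrX nw1 -real_complexX in cMj.
  have -> : s ^+ j = (r / 2) ^+ j * 4^-1 ^+ j.
    by rewrite -exprMn /s -mulrA -invfM -natrM.
  rewrite !real_complexM mulrA.
  by rewrite ler_wpM2r// (ler_complex 0) exprn_ge0.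
have Dc : cvgn (series (D : nat -> C)).
  apply: (@geometric_cvg_series _ _ (M / s) 2^-1); first by rewrite divr_ge0// ltW.
    by rewrite invr_ge0 ler0n/= invf_lt1// ltr1n.
  case=> [|j]; first by rewrite /D mul0r mulr0 normr0 (ler_complex 0) !mulr_ge0// invr_ge0 ltW.
  rewrite /D /= !normrM normrX normr_nat.
  apply: (@le_trans _ _ (`|c j.+1| * (s ^+ j.+1)%:C * (2 ^+ j.+1 / s)%:C)).
    rewrite -!mulrA ler_wpM2l// -real_complexM.
    have -> : s ^+ j.+1 * (2 ^+ j.+1 / s) = 2 ^+ j.+1 * s ^+ j.
      by rewrite [s ^+ _]exprS; field; rewrite gt_eqF.
    rewrite real_complexM !real_complexX ler_pM ?exprn_ge0//.
      by rewrite rmorph_nat -natrX ler_nat ltnW// ltn_expl.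
    by rewrite lerXn2r ?nnegrE// (ler_complex 0) ltW.
  apply: (@le_trans _ _ ((M * 4^-1 ^+ j.+1)%:C * (2 ^+ j.+1 / s)%:C)).
    by rewrite ler_wpM2r// (ler_complex 0) divr_ge0 ?exprn_ge0// ltW.
  rewrite -real_complexM ler_complex.
  have -> : 4^-1 = 2^-1 * 2^-1 :> R by rewrite -invfM -natrM.
  have e2 : 2 ^+ j.+1 * 2^-1 ^+ j.+1 = 1 :> R.
    by rewrite -exprMn divff ?expr1n// pnatr_eq0.
  rewrite [(_ * _) ^+ _]exprMn; set x := 2^-1 ^+ j.+1 in e2 *; set y := 2 ^+ j.+1 in e2 *.
  have -> // : M * (x * x) * (y / s) = M / s * x.
  by rewrite -[RHS]mulr1 -e2; ring.
apply/cvg_ex; exists (limn (series (D : nat -> C))).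
have bound h : `|h| < (s / 2)%:C ->
    `|S (w + h) - S w - limn (series (D : nat -> C)) * h| <= (2 * M / s ^+ 2)%:C * `|h| ^+ 2.
  move=> hs; have [k k0 hk] := nneg_complexE (normr_ge0 (h : R[i])).
  pose a := k ^+ 2 / s ^+ 2.
  have whs : `|w + h| <= s%:C.
    by rewrite (le_trans (ler_normD _ _))// -s2s real_complexD lerD// ltW.
  have lim : series (fun j => c j * (w + h) ^+ j - c j * w ^+ j - D j * h : C)
      @ \oo --> (S (w + h) - S w - limn (series (D : nat -> C)) * h : C).
    have sr : (s < r)%R by rewrite ltr_pdivrMr// ltr_pMr// ltr1n.
    rewrite (_ : series _ = (fun n => series (fun j => c j * (w + h) ^+ j : C) n -
      series (fun j => c j * w ^+ j : C) n - series D n * h : C)); last first.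
      by apply/funext => n; rewrite /series /= !sumrB mulr_suml.
    apply: cvgB; first apply: cvgB.
    - by apply: cS; rewrite (le_lt_trans whs)// ltr_complex.
    - by apply: cS; rewrite (le_lt_trans ws')// ltr_complex.
    - rewrite (_ : (fun _ => _) = (fun n => h * series (D : nat -> C) n : C)).
        by rewrite mulrC; exact: cvg_mull.
      by apply/funext => n; rewrite mulrC.
  have a0 : 0 <= a by rewrite divr_ge0// exprn_ge0// ltW.
  have -> : (2 * M / s ^+ 2)%:C * `|h| ^+ 2 = (2 * (M * a))%:C :> R[i].
    by rewrite hk -real_complexX -real_complexM /a; congr (_%:C); ring.
  apply: (cvg_norm_le lim) => n; apply: geometric_series_norm => [|j]; first exact: mulr_ge0.
  have -> : c j * (w + h) ^+ j - c j * w ^+ j - D j * h =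
    c j * ((w + h) ^+ j - w ^+ j - j%:R * w ^+ j.-1 * h) by rewrite /D; ring.
  rewrite normrM.
  have ha : `|h| ^+ 2 = (a * s ^+ 2)%:C.
    by rewrite hk -real_complexX /a divfK// expf_neq0// gt_eqF.
  rewrite (le_trans (ler_wpM2l (normr_ge0 _) (expr_taylor_bound j (ltW s0) ws' whs ha a0)))//.
  have -> : (a * (2 * s) ^+ j)%:C = (s ^+ j)%:C * (a * 2 ^+ j)%:C :> R[i].
    by rewrite -real_complexM exprMn; congr (_%:C); ring.
  have p0 : 0 <= a * 2 ^+ j by rewrite mulr_ge0// exprn_ge0.
  rewrite mulrA (le_trans (ler_wpM2r _ (cb j))) ?(ler_complex 0)//.
  rewrite -real_complexM ler_complex.
  have -> : 2^-1 = 4^-1 * 2 :> R by field.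
  by rewrite exprMn le_eqVlt; apply/orP; left; apply/eqP; ring.
apply/cvgrPdist_lt => _ /pos_complexE[e e0 ->].
have K0 : 0 < 2 * M / s ^+ 2 + 1 by rewrite ltr_wpDl// divr_ge0 ?mulr_ge0 ?exprn_ge0// ltW.
near=> h.
have h0 : h != 0 by near: h; exact: nbhs_dnbhs_neq.
have -> : limn (series (D : nat -> C)) - h^-1 *: (((S : C -> C) \o shift (w : C)) h%:A - S w)
    = - (h^-1 * (S (w + h) - S w - limn (series (D : nat -> C)) * h)) :> R[i].
  by rewrite /= /GRing.scale /= mulr1 [h + w]addrC; field.
have hs : `|h| < (s / 2)%:C.
  by near: h; apply: dnbhs0_lt; rewrite (ltr_complex 0) divr_gt0.
rewrite normrN normrM normfV mulrC ltr_pdivrMr ?normr_gt0//.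
rewrite (le_lt_trans (bound _ hs))// expr2 mulrA ltr_pM2r ?normr_gt0//.
apply: (@le_lt_trans _ _ ((2 * M / s ^+ 2 + 1)%:C * `|h|)).
  by rewrite ler_wpM2r// ler_complex lerDl.
have hK : `|h| < (e / (2 * M / s ^+ 2 + 1))%:C.
  by near: h; apply: dnbhs0_lt; rewrite (ltr_complex 0) divr_gt0.
have -> : e%:C = (2 * M / s ^+ 2 + 1)%:C * (e / (2 * M / s ^+ 2 + 1))%:C :> R[i].
  by rewrite -real_complexM mulrCA divff ?mulr1// gt_eqF.
have K0c : 0 < (2 * M / s ^+ 2 + 1)%:C :> R[i] by rewrite (ltr_complex 0).
by rewrite (ltr_pM2l K0c).
Unshelve. all: by end_near. Qed.

End PowerSeriesLocal.

(** * Meromorphic functions *)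

Section Meromorphic.
Context {R : realType}.
Local Notation C := (R[i]^o).
Implicit Types (F : R[i] -> R[i]) (P : R[i] -> Prop) (z w tau : R[i]).

Lemma near_complexP P z0 : (\forall z \near (z0 : C), P z) <->
  exists2 r : R, 0 < r & forall z, `|z - z0| < r%:C -> P z.
Proof.
split.
  move/nbhs_normP => -[e /= /pos_complexE[r r0 ->] rP].
  by exists r => // z zr; apply: rP; rewrite /= distrC.
move=> [r r0 rP]; apply/nbhs_normP; exists r%:C => /=; first by rewrite (ltr_complex 0).
by move=> z /= zr; apply: rP; rewrite distrC.
Qed.

Lemma dnear_complexP P z0 : (\forall z \near (z0 : C)^', P z) <->
  exists2 r : R, 0 < r & forall z, z != z0 -> `|z - z0| < r%:C -> P z.
Proof.
rewrite /dnbhs; split.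
  move=> /(near_complexP (fun z => z != z0 -> P z))[r r0 rP].
  by exists r => // z zz0 zr; apply: rP.
move=> [r r0 rP]; apply/(near_complexP (fun z => z != z0 -> P z)).
by exists r => // z zr zz0; apply: rP.
Qed.

Lemma dnear_ex P z0 : (\forall z \near (z0 : C)^', P z) -> exists z, P z.
Proof. exact: filter_ex. Qed.

(** Makes the set of points having P on a punctured neighbourhood open, as the connectedness
    argument requires. *)
Lemma dnear_dnear P z0 : (\forall z \near (z0 : C)^', P z) ->
  \forall z \near (z0 : C), \forall w \near (z : C)^', P w.
Proof.
move/dnear_complexP => [r r0 rP]; apply/near_complexP; exists r => // z zr.
have [->|zz0] := eqVneq z z0; first by apply/dnear_complexP; exists r.
have [d d0 zd] : exists2 d : R, 0 < d & `|z - z0| = d%:C.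
  by apply: pos_complexE; rewrite normr_gt0 subr_eq0.
(* Radius d keeps w away from z0, and r - d keeps it inside the original disc. *)
apply/dnear_complexP; exists (Num.min d (r - d)).
  by rewrite lt_min d0 subr_gt0 -ltr_complex -zd.
move=> w _ wz; apply: rP.
  apply: contraTneq wz => ->; rewrite distrC zd ltr_complex lt_min ltxx //.
have wzd : `|w - z| < (r - d)%:C.
  by rewrite (lt_le_trans wz)// ler_complex ge_min lexx orbT.
have -> : w - z0 = (w - z) + (z - z0) by rewrite addrA subrK.
rewrite (le_lt_trans (ler_normD _ _))// zd -[r](subrK d) real_complexD.
by rewrite ltrD2r.
Qed.

(** Turns an equality off z0 into equalities on full neighbourhoods of the nearby points, where it
    can be differentiated. *)
Lemma dnear_near P z0 : (\forall z \near (z0 : C)^', P z) ->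
  \forall z \near (z0 : C)^', \forall w \near (z : C), P w.
Proof.
move/dnear_complexP => [r r0 rP]; apply/dnear_complexP; exists r => // z zz0 zr.
have [d d0 zd] : exists2 d : R, 0 < d & `|z - z0| = d%:C.
  by apply: pos_complexE; rewrite normr_gt0 subr_eq0.
apply/near_complexP; exists (Num.min d (r - d)).
  by rewrite lt_min d0 subr_gt0 -ltr_complex -zd.
move=> w wz; apply: rP.
  apply: contraTneq wz => ->; rewrite distrC zd ltr_complex lt_min ltxx //.
have wzd : `|w - z| < (r - d)%:C.
  by rewrite (lt_le_trans wz)// ler_complex ge_min lexx orbT.
have -> : w - z0 = (w - z) + (z - z0) by rewrite addrA subrK.
rewrite (le_lt_trans (ler_normD _ _))// zd -[r](subrK d) real_complexD.
by rewrite ltrD2r.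
Qed.

Lemma cvg_series0 (a : R[i]) :
  series (fun j => (if j is 0 then a else 0) : C) @ \oo --> (a : C).
Proof.
rewrite -(cvg_shiftS (series _)).
rewrite (_ : (fun n => _) = cst (a : C)); first exact: cvg_cst.
apply/funext => n; rewrite /series /= big_nat_recl//= big1 ?addr0// => i _.
Qed.

Lemma meromorphic_pseries F z0 : meromorphic_at F z0 ->
  exists (m : nat) (c : nat -> R[i]) (S : R[i] -> R[i]) (r : R),
  [/\ 0 < r,
      forall w, `|w| < r%:C ->
        series (fun j => c j * w ^+ j : C) @ \oo --> (S w : C) &
      forall w, w != 0 -> `|w| < r%:C -> F (z0 + w) = S w / w ^+ m].
Proof.
move=> [m [c /dnear_complexP[r r0 rP]]].
(* At w = 0 the expansion says nothing about F, whose value there is meaningless; the power series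
   sums to its constant term. *)
exists m, c, (fun w => if w == 0 then c 0%N else w ^+ m * F (z0 + w)), r; split => //.
  move=> w wr; case: eqVneq => [->|w0].
    rewrite (_ : (fun _ => _) = (fun j => (if j is 0 then c 0%N else 0) : C)).
      exact: cvg_series0.
    by apply/funext => -[|j] /=; rewrite ?expr0 ?mulr1// exprS mul0r mulr0.
  have := rP (z0 + w); rewrite addrAC subrr add0r; apply => //.
  by rewrite -subr_eq0 addrAC subrr add0r.
by move=> w w0 wr; rewrite (negPf w0) mulrAC divff ?mul1r// expf_neq0.
Qed.

Lemma meromorphic_derivable F z0 : meromorphic_at F z0 ->
  \forall z \near (z0 : C)^', derivable (F : C -> C) (z : C) 1.
Proof.
move=> /meromorphic_pseries[m [c [S [r [r0 cS FS]]]]].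
have [d d0 dS] := pseries_derivable r0 cS.
apply: filter_app (dnear_near (P := fun z => F z = S (z - z0) / (z - z0) ^+ m) _); last first.
  apply/dnear_complexP; exists r => // z zz0 zr.
  by rewrite -FS ?subr_eq0// addrC subrK.
apply/dnear_complexP; exists d => // z zz0 zd Fz.
apply: (@derivable_near_eq _ (fun z => S (z - z0) / (z - z0) ^+ m : C)).
  by apply: filterS Fz => w ->.
have sh := @derivable_subc R[i] z0 z.
apply: derivable_mul.
  under eq_fun do rewrite -[X in X - z0]mul1r.
  by apply: (@derivable_affine _ S 1 (- z0)); rewrite mul1r; exact: dS.
by apply: derivable_inv; [rewrite expf_neq0// subr_eq0|exact: derivable_exp].
Qed.

(** If some Laurent coefficient is nonzero, the first such c_k is the constant term of S(w) / w^k,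
    which therefore does not vanish near 0; the remaining factor is a power of w. *)
Lemma meromorphic_dichotomy F z0 : meromorphic_at F z0 ->
  (\forall z \near (z0 : C)^', F z = 0) \/ (\forall z \near (z0 : C)^', F z != 0).
Proof.
move=> /meromorphic_pseries[m [c [S [r [r0 cS FS]]]]].
have [c0|] := pselect (forall j, c j = 0).
  left; apply/dnear_complexP; exists r => // z zz0 zr.
  rewrite -[z](subrK z0) addrC FS ?subr_eq0//.
  have := cS _ zr; rewrite (_ : (fun _ => _) = (fun j => (if j is 0 then 0 else 0) : C)).
    by move/(regular_cvg_unique (@cvg_series0 0)) => <-; rewrite mul0r.
  by apply/funext => -[|j]; rewrite c0 mul0r.
move=> /existsNP/cid[k0 /eqP ck0].
have [k ck kmin] := ex_minnP (ex_intro (fun j => c j != 0) _ ck0).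
right; have r20 : 0 < r / 2 by rewrite divr_gt0.
pose w1 : R[i] := (r / 2)%:C.
have nw1 : `|w1| = (r / 2)%:C :> R[i] by rewrite normc_real ger0_norm// ltW.
have w10 : w1 != 0 by rewrite -normr_gt0 nw1 (ltr_complex 0).
have shifted w : w != 0 -> `|w| < r%:C ->
    series (fun j => c (j + k)%N * w ^+ j : C) @ \oo --> (S w / w ^+ k : C).
  move=> w0 wr.
  have -> : series (fun j => c (j + k)%N * w ^+ j : C) =
     (fun n => (w ^+ k)^-1 * series (fun j => c j * w ^+ j : C) (n + k)%N : C).
    apply/funext => n; rewrite /series /= addnC [X in _ * X](@big_cat_nat _ _ _ k)/= ?leq_addr//.
    rewrite [X in _ * (X + _)]big_nat [X in _ * (X + _)]big1 ?add0r => [|j /andP[_ jk]]; last first.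
      by apply/eqP; rewrite mulf_eq0; apply/orP; left; apply: contraTT jk => /kmin; rewrite leqNgt.
    rewrite [in RHS](_ : \sum_(k <= i < k + n) _ = \sum_(0 <= i < n) c (i + k)%N * w ^+ (i + k)) ?mulr_sumr; last first.
      by rewrite -{1}[k]add0n big_addn addKn.
    apply: eq_bigr => j _.
    by rewrite exprD mulrCA [w ^+ j * _]mulrC mulKf// expf_neq0.
  rewrite mulrC; apply: cvg_mull.
  by rewrite (cvg_shiftn k (series _)); apply: cS.
have [||d d0 dS] := @pseries_neq0 _ (fun j => c (j + k)%N) w1 w10; rewrite ?add0n//.
  apply/cvg_ex; eexists; apply: shifted => //.
  by rewrite nw1 ltr_complex ltr_pdivrMr// ltr_pMr// ltr1n.
apply/dnear_complexP; exists (Num.min d r); first by rewrite lt_min d0.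
move=> z zz0 zdr; have zz0' : z - z0 != 0 by rewrite subr_eq0.
have zd : `|z - z0| < d%:C by rewrite (lt_le_trans zdr)// ler_complex ge_min lexx.
have zr : `|z - z0| < r%:C by rewrite (lt_le_trans zdr)// ler_complex ge_min lexx orbT.
have -> : F z = S (z - z0) / (z - z0) ^+ m by rewrite -FS// addrC subrK.
have := dS _ _ zd (shifted _ zz0' zr); rewrite !mulf_eq0 !invr_eq0 !expf_eq0.
by rewrite (negPf zz0') !andbF !orbF.
Qed.

End Meromorphic.

(** * Fourier expansions and the identity theorem *)

Section FourierExpansion.
Context {R : realType}.
Local Notation C := (R[i]^o).
Implicit Types (F : R[i] -> R[i]) (c : nat -> R[i]) (z w tau : R[i]).

Lemma cexpD z w : cexp (z + w) = cexp z * cexp w.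
Proof.
case: z w => [a b] [x y]; rewrite /cexp /= expRD cosD sinD.
by simpc; congr (_ +i* _); ring.
Qed.

Lemma norm_cexp z : `|cexp z| = (expR (complex.Re z))%:C.
Proof.
rewrite /cexp normrM normc_real (ger0_norm (expR_ge0 _)) normc_def /= cos2Dsin2.
by rewrite sqrtr1 mulr1.
Qed.

Lemma cexp_neq0 z : cexp z != 0.
Proof. by rewrite -normr_gt0 norm_cexp (ltr_complex 0) expR_gt0. Qed.

Lemma cexp0 : cexp (0 : R[i]) = 1.
Proof. by rewrite /cexp /= expR0 cos0 sin0 mulr1. Qed.

Lemma cexpX z n : cexp (n%:R * z) = cexp z ^+ n.
Proof.
elim: n => [|n IH]; first by rewrite mul0r cexp0 expr0.
by rewrite exprS -IH -cexpD -natr1 mulrDl mul1r addrC.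
Qed.

Lemma qpow_neq0 h tau : qpow h tau != 0 :> R[i].
Proof. exact: cexp_neq0. Qed.

Lemma norm_qpow (h : R) tau :
  `|qpow h tau| = (expR (- (2 * pi * h * complex.Im tau)))%:C.
Proof.
rewrite /qpow norm_cexp; congr ((expR _)%:C).
by case: tau => x y /=; ring.
Qed.

Lemma qpow_nat j tau : qpow (j%:R : R) tau = qpow 1 tau ^+ j.
Proof.
rewrite /qpow -cexpX mulr1; congr cexp.
by rewrite real_complexM rmorph_nat -!mulrA [in LHS]mulrCA.
Qed.

Lemma Im_affine (a b d : nat) z : complex.Im ((a%:R * z + b%:R) / d%:R) =
  a%:R / d%:R * complex.Im z.
Proof.
have natC k : k%:R = (k%:R : R)%:C :> R[i] by rewrite rmorph_nat.
rewrite !natC -fmorphV; case: z => x y /=.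
by rewrite !(mul0r, mulr0, addr0, add0r); ring.
Qed.

Lemma uhp_affine (a b d : nat) z : (0 < a)%N -> (0 < d)%N -> uhp z ->
  uhp ((a%:R * z + b%:R) / d%:R).
Proof.
by move=> a0 d0 uz; rewrite /uhp Im_affine mulr_gt0// divr_gt0// ltr0n.
Qed.

Lemma Im_sub_lt z w (r : R) : `|z - w| < r%:C -> complex.Im w - r < complex.Im z.
Proof.
move=> zw; have := le_lt_trans (normc_ge_Im (z - w : C)) zw.
rewrite ltr_complex ltr_norml raddfB => /andP[+ _].
by rewrite /= ltrBrDr addrC.
Qed.

Lemma fourier_neq0 F (h : R) c : fourier_expansion F h 1 c -> c 0%N != 0 ->
  exists Y : R, forall tau, Y < complex.Im tau ->
    \forall z \near (tau : C)^', F z != 0.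
Proof.
move=> [Y Y0 [S cS FS]] c0.
have qE j tau : qpow (j%:R / 1%:R : R) tau = qpow 1 tau ^+ j.
  by rewrite divr1 qpow_nat.
have [r r0 rS] : exists2 r : R, 0 < r & forall w l, `|w| < r%:C ->
    series (fun j => c j * w ^+ j : C) @ \oo --> (l : C) -> l != 0.
  (* The point (Y + 1) i lies in the region of convergence, and its q is a nonzero point where the
     power series converges. *)
  apply: (@pseries_neq0 _ c (qpow 1 ((Y + 1)%:C * 'i))) => //; first exact: qpow_neq0.
  apply/cvg_ex; exists (S ((Y + 1)%:C * 'i)).
  under eq_fun do rewrite -qE.
  by apply: cS; rewrite /= mulr1 mulr0 addr0 ltrDl.
(* Since |q| = exp(- 2 pi Im tau), 2 pi >= 1 and Im tau > Y > 0, the condition Im tau > - ln r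
   forces |q| < r. *)
exists (Num.max Y (- ln r)) => tau; rewrite gt_max => /andP[Ytau rtau].
have near_Im : \forall z \near (tau : C)^', Num.max Y (- ln r) < complex.Im z.
  apply/dnear_complexP; exists (complex.Im tau - Num.max Y (- ln r)).
    by rewrite subr_gt0 gt_max Ytau.
  by move=> z _ /Im_sub_lt; rewrite opprB addrC subrK.
apply: filter_app (FS tau Ytau); apply: filterS near_Im => z.
rewrite gt_max => /andP[Yz rz] ->; rewrite mulf_neq0 ?qpow_neq0//.
apply: (rS (qpow 1 z)); last by under eq_fun do rewrite -qE; exact: cS.
rewrite norm_qpow ltr_complex -[r]lnK ?posrE// ltr_expR mulr1 ltrNl (lt_le_trans rz)//.
have pi1 : 1 <= 2 * pi :> R by have := pi_ge2 R; lra.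
by rewrite ler_peMl// ltW// (lt_trans Y0).
Qed.

Lemma fourier_zero (h : R) c : fourier_expansion (fun=> 0) h 1 c -> c 0%N = 0.
Proof.
move=> Fc; apply/eqP/negP => /negP /(fourier_neq0 Fc)[Y].
have ImE : Y < complex.Im ((Y + 1)%:C * 'i) by rewrite /= mulr1 mul0r addr0 ltrDl.
move=> /(_ _ ImE) /dnear_ex.
by move=> [z]; rewrite eqxx.
Qed.

(** Vanishing near z0 would propagate up the vertical segment above z0, by connectedness, to a
    height where the leading Fourier coefficient excludes it. *)
Lemma meromorphic_neq0 F (h : R) c :
    (forall tau, uhp tau -> meromorphic_at F tau) ->
    fourier_expansion F h 1 c -> c 0%N != 0 ->
  forall tau, uhp tau -> \forall z \near (tau : C)^', F z != 0.
Proof.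
move=> merF Fc c0 z0 uz0; have [Y FY] := fourier_neq0 Fc c0.
have [F0|//] := meromorphic_dichotomy (merF _ uz0); exfalso.
pose g (t : R) : R[i] := z0 + t%:C * 'i.
have gIm t : complex.Im (g t) = complex.Im z0 + t.
  by rewrite /g raddfD /= mulr1 mul0r addr0.
have g0 : g 0 = z0 by rewrite /g rmorph0 mul0r addr0.
have near_g (P : R[i] -> Prop) t : (\forall z \near (g t : C)^', P z) ->
    \forall s \near t, \forall z \near (g s : C)^', P z.
  move=> /dnear_dnear/near_complexP[r r0 rP].
  apply/nbhs_normP; exists r => //= s ts; apply: rP.
  have -> : g s - g t = (s - t)%:C * 'i by rewrite /g raddfB /=; ring.
  by rewrite normrM norm_i mulr1 normc_real ltr_complex distrC.
(* As Im z0 > 0, the point z0 + i T lies above height Y; the maximum with 0 keeps the segment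
   nonempty. *)
pose T := Num.max 0 (Y + 1).
have T0 : 0 <= T by rewrite le_max lexx.
pose A := [set t | \forall z \near (g t : C)^', F z = 0].
pose B := [set t | \forall z \near (g t : C)^', F z != 0].
have AB t : A t -> B t -> False.
  move=> At Bt; have [z []] := dnear_ex (filterI At Bt).
  by move=> ->; rewrite eqxx.
have : `[0, T] `&` A = `[0, T]%classic.
  apply: segment_connected.
  - exists 0; split; first by rewrite /= in_itv/= lexx.
    by have : \forall z \near (g 0 : C)^', F z = 0 by rewrite g0.
  - by exists A => //; rewrite openE => t At; exact: (near_g (fun z => F z = 0)).
  (* By the dichotomy, A is on the segment the complement of the open set B, hence relatively
     closed. *)
  - exists (~` B); first by apply: open_closedC; rewrite openE => t Bt; exact: (near_g (fun z => F z != 0)).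
    apply/seteqP; split=> t /= [tT].
      by move=> At; split; [exact: tT|exact: (AB t At)].
    move=> Bt; split; first exact: tT.
    have ugt : uhp (g t).
      by rewrite /uhp gIm ltr_wpDr//; move: tT; rewrite in_itv/= => /andP[].
    by case: (meromorphic_dichotomy (merF _ ugt)) => [Ft|Ft]; [exact: Ft|case: (Bt Ft)].
move=> AE; have [_ AT] : (`[0, T] `&` A)%classic T.
  by rewrite AE /= in_itv/= lexx T0.
have YT : Y < complex.Im (g T).
  rewrite gIm (@lt_le_trans _ _ (Y + 1)) ?ltrDl// -[leLHS]add0r.
  by rewrite lerD ?(ltW uz0)// le_max lexx orbT.
exact: (AB T AT (FY _ YT)).
Qed.

(** A normaliser e = 0 would give the zero function leading coefficient 1, and the default value 1
    is nonzero as well. Hence the normaliser always cancels in logarithmic derivatives. *)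
Lemma lead_normalizer_neq0 F : lead_normalizer F != 0.
Proof.
rewrite /lead_normalizer; case: xgetP => [e _ [] _ [h [c [Fc c01]]]|_]; last exact: oner_neq0.
apply: contraTneq isT => e0; move: Fc; rewrite e0.
under eq_fun do rewrite mul0r.
by move/fourier_zero/eqP; rewrite c01 oner_eq0.
Qed.

End FourierExpansion.

(** * Divisor sums *)

Section DivisorSums.
Local Open Scope nat_scope.

Lemma dvdn_mul_gcd x m n : coprime m n -> x %| m * n -> gcdn x m * gcdn x n = x.
Proof.
move=> cmn xmn; apply/eqP; rewrite eqn_dvd; apply/andP; split.
  rewrite Gauss_dvd ?dvdn_gcdl//.
  exact: coprime_dvdl (dvdn_gcdr _ _) (coprime_dvdr (dvdn_gcdr _ _) cmn).
rewrite muln_gcdl !muln_gcdr !dvdn_gcd xmn.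
by rewrite !(dvdn_mulr _ (dvdnn x)) (dvdn_mull _ (dvdnn x)).
Qed.

(** The inverse of (d, e) -> d e is x -> (gcd(x, m), gcd(x, n)). *)
Lemma perm_divisors_coprime m n : coprime m n -> 0 < m -> 0 < n ->
  perm_eq (divisors (m * n)) [seq d * e | d <- divisors m, e <- divisors n].
Proof.
move=> cmn m0 n0.
have gcd1 d e : d %| m -> e %| n -> gcdn (d * e) m = d /\ gcdn (d * e) n = e.
  move=> dm en; have cdn := coprime_dvdl dm cmn; have cme := coprime_dvdr en cmn.
  rewrite ![gcdn (d * e) _]gcdnC Gauss_gcdl// Gauss_gcdr 1?coprime_sym//.
  by split; apply/gcdn_idPr.
apply: uniq_perm; first exact: divisors_uniq.
  apply: allpairs_uniq; [exact: divisors_uniq|exact: divisors_uniq|].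
  move=> [d e] [d' e'] /allpairsP[[u v] /= [+ + [-> ->]]] /allpairsP[[u' v'] /= [+ + [-> ->]]].
  rewrite -!dvdn_divisors// => um vn um' vn' E.
  have [g1 g2] := gcd1 _ _ um vn; have [g1' g2'] := gcd1 _ _ um' vn'.
  by congr pair; [rewrite -g1 E g1'|rewrite -g2 E g2'].
move=> x; rewrite -dvdn_divisors ?muln_gt0 ?m0//; apply/idP/allpairsP.
  move=> xmn; exists (gcdn x m, gcdn x n) => /=.
  by rewrite -!dvdn_divisors// !dvdn_gcdr dvdn_mul_gcd.
by move=> [[d e] /= []]; rewrite -!dvdn_divisors// => dm en ->; exact: dvdn_mul.
Qed.

Lemma perm_divisors_pfactor p r : prime p ->
  perm_eq (divisors (p ^ r)) [seq p ^ i | i <- iota 0 r.+1].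
Proof.
move=> pp; have p1 := prime_gt1 pp.
apply: uniq_perm; first exact: divisors_uniq.
  rewrite map_inj_uniq ?iota_uniq// => i j /eqP; rewrite eqn_exp2l//.
  by move/eqP.
move=> x; rewrite -dvdn_divisors ?expn_gt0 ?prime_gt0//; apply/idP/mapP.
  by move/(dvdn_pfactor _ _ pp) => [i ir ->]; exists i; rewrite // mem_iota.
by move=> [k]; rewrite mem_iota/= add0n ltnS => kr ->; rewrite dvdn_exp2l.
Qed.

Lemma sigma1 : sigma 1 = 1.
Proof. by rewrite /sigma (_ : divisors 1 = [:: 1]) ?big_seq1. Qed.

Lemma sigma_coprime m n : coprime m n -> 0 < m -> 0 < n ->
  sigma (m * n) = (sigma m * sigma n)%N.
Proof.
move=> cmn m0 n0.
rewrite /sigma (perm_big _ (perm_divisors_coprime cmn m0 n0))/= big_allpairs_dep.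
by rewrite big_distrl; apply: eq_bigr => d _; rewrite big_distrr.
Qed.

Lemma sigma_pfactor p r : prime p -> sigma (p ^ r) = (\sum_(i < r.+1) p ^ i)%N.
Proof.
move=> pp; rewrite /sigma (perm_big _ (perm_divisors_pfactor r pp)) big_map.
by rewrite -[iota 0 r.+1]/(index_iota 0 r.+1) big_mkord.
Qed.

Lemma sigma_pfactorS p r : prime p -> sigma (p ^ r.+1) = (1 + p * sigma (p ^ r))%N.
Proof.
move=> pp; rewrite !sigma_pfactor// big_ord_recl expn0 big_distrr/=; congr addn.
by apply: eq_bigr => i _; rewrite /bump /= -expnS add1n.
Qed.

Lemma sigma_pfactorD p r s : prime p ->
  sigma (p ^ (r + s).+1) = (sigma (p ^ s) + p ^ s.+1 * sigma (p ^ r))%N.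
Proof.
move=> pp; rewrite !sigma_pfactor// big_distrr/=.
have -> : (r + s).+2 = s.+1 + r.+1 by rewrite addSn addnS addnC.
rewrite big_split_ord; congr addn.
by apply: eq_bigr => i _; rewrite /= expnD.
Qed.

(** This is the Hecke relation for sigma at prime powers. The term j = 0 is split off; the terms j
    >= 1 are p times the identity with both exponents lowered by one. *)
Lemma sigma_pfactorM p r s : prime p ->
  (\sum_(j < r.+1 | j <= s) p ^ j * sigma (p ^ (r - j) * p ^ (s - j)))%N =
  (sigma (p ^ r) * sigma (p ^ s))%N.
Proof.
move=> pp; elim: r s => [|r IH] s.
  by rewrite big_mkcond big_ord1/= !subn0 expn0 sigma1 !mul1n.
case: s => [|s].
  rewrite big_mkcond big_ord_recl/= big1 ?addn0 => [|k _]; last by [].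
  by rewrite expn0 !subn0 mul1n !muln1 sigma1 muln1.
rewrite big_mkcond big_ord_recl/= expn0 mul1n !subn0 -expnD.
have -> : (\sum_(i < r.+1) (if bump 0 i <= s.+1 then
   p ^ bump 0 i * sigma (p ^ (r.+1 - bump 0 i) * p ^ (s.+1 - bump 0 i)) else 0) =
   p * (\sum_(j < r.+1 | j <= s) p ^ j * sigma (p ^ (r - j) * p ^ (s - j))))%N.
  rewrite big_distrr/= [RHS]big_mkcond; apply: eq_bigr => i _.
  by rewrite /bump /= add1n ltnS !subSS expnS mulnA.
have -> : r.+1 + s.+1 = (r + s.+1).+1 by rewrite addSn.
have sS : sigma (p ^ s.+1) = sigma (p ^ s) + p ^ s.+1.
  by have := sigma_pfactorD 0 s pp; rewrite add0n expn0 sigma1 muln1.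
rewrite IH sigma_pfactorD// (sigma_pfactorS r pp) sS [p ^ s.+2]expnS.
by set a := sigma _; set b := sigma _; set c := p ^ s.+1; ring.
Qed.

(* [divisors 0 = [:: 1]], so that [sigma 0 = 1] is a junk value. *)
Definition sigma_pos n := if n is 0 then 0 else sigma n.

Lemma sigma_posE n : 0 < n -> sigma_pos n = sigma n.
Proof. by case: n. Qed.

(** With a = p^r / d, the argument d (k / a) is p^r k / a^2. For k = p^s m with p not dividing m,
    sigma(m) factors out, and the sum over a = p^j with j <= min(r, s) is [sigma_pfactorM]. For k =
    0 both sides vanish. *)
Lemma sigma_hecke p r k : prime p ->
  (\sum_(d <- divisors (p ^ r) | p ^ r %/ d %| k)
     (p ^ r %/ d) * sigma_pos (d * (k %/ (p ^ r %/ d))))%N =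
  (sigma (p ^ r) * sigma_pos k)%N.
Proof.
move=> pp; have p0 := prime_gt0 pp.
have [->|k0] := posnP k.
  by rewrite muln0 big1// => d _; rewrite div0n muln0 muln0.
have [m cpm kE] := pfactor_coprime pp k0; set s := logn p k in kE.
have m0 : 0 < m by move: k0; rewrite kE muln_gt0 => /andP[].
have sk : sigma_pos k = sigma (p ^ s) * sigma m.
  by rewrite sigma_posE// kE mulnC sigma_coprime ?expn_gt0 ?p0// coprimeXl.
rewrite (perm_big _ (perm_divisors_pfactor r pp)) big_map.
rewrite -[iota 0 r.+1]/(index_iota 0 r.+1) big_mkord sk mulnA -(sigma_pfactorM r s pp).
rewrite big_distrl/= (reindex_inj rev_ord_inj)/=.
have div_p (j : 'I_r.+1) : p ^ r %/ p ^ (r - j) = p ^ j.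
  by rewrite -expnB ?leq_subr// subKn// -ltnS.
apply: eq_big => [j|j]; rewrite subSS div_p pfactor_dvdn// => js.
have kj : k %/ p ^ j = m * p ^ (s - j).
  have sE : s = s - j + j by rewrite subnK.
  by rewrite [k in LHS]kE {1}sE expnD mulnA mulnK// expn_gt0 p0.
have -> : p ^ (r - j) * (k %/ p ^ j) = p ^ (r - j) * p ^ (s - j) * m.
  by rewrite kj [m * _]mulnC mulnA.
rewrite -[RHS]mulnA sigma_posE ?muln_gt0 ?expn_gt0 ?p0// (@sigma_coprime (_ * _) m)//.
  by rewrite -expnD coprimeXl.
by rewrite muln_gt0 !expn_gt0 p0.
Qed.

(** The map d -> n / d is an involution of the divisors. The sum is what T_2 makes of the constant
    term of E_2. *)
Lemma sigma_div n : 0 < n -> \sum_(d <- divisors n) n %/ d = sigma n.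
Proof.
move=> n0; rewrite -(big_map (fun d => n %/ d) xpredT id); apply: perm_big.
have divK d : d %| n -> n %/ (n %/ d) = d.
  move=> dn; have q0 : 0 < n %/ d.
    by rewrite divn_gt0 ?(dvdn_leq n0 dn)// (dvdn_gt0 n0 dn).
  by have := mulKn d q0; rewrite (divnK dn).
apply: uniq_perm; last first.
- move=> d; apply/mapP/idP => [[e + ->]|]; rewrite -!dvdn_divisors// => en.
    by apply/dvdnP; exists e; rewrite mulnC divnK.
  by exists (n %/ d); rewrite -?dvdn_divisors ?divK//; apply/dvdnP; exists d; rewrite mulnC divnK.
- exact: divisors_uniq.
rewrite map_inj_in_uniq ?divisors_uniq// => d e.
by rewrite -!dvdn_divisors// => dn en /(congr1 (divn n)); rewrite !divK.
Qed.

Lemma sum_dvdn_mul (V : nmodType) d K (f : nat -> V) : 0 < d ->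
  (\sum_(0 <= m < (d * K)%N | (d %| m)%N) f m = \sum_(0 <= l < K) f (d * l)%N)%R.
Proof.
move=> d0; elim: K => [|K IH]; first by rewrite muln0 !big_geq.
rewrite mulnS addnC (@big_cat_nat _ _ _ (d * K))//= ?leq_addr// IH big_nat_recr//=.
congr (_ + _)%R; rewrite -[d * K in LHS]add0n big_addn addKn.
rewrite big_ltn_cond// dvdn_mulr//= add0n big1_seq ?addr0// => i /andP[].
rewrite dvdn_addl ?dvdn_mulr// mem_index_iota => di /andP[i0 id].
by move: (dvdn_leq i0 di); rewrite leqNgt id.
Qed.

End DivisorSums.

(** * The Eisenstein series of weight 2 *)

Section EisensteinTwo.
Context {R : realType}.
Local Notation C := (R[i]^o).
Implicit Types (z w tau : R[i]).

Lemma qpow1D z w : qpow 1 (z + w) = qpow 1 z * qpow 1 w :> R[i].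
Proof. by rewrite /qpow mulrDr cexpD. Qed.

Lemma qpow1X n z : qpow 1 (n%:R * z) = qpow 1 z ^+ n :> R[i].
Proof. by rewrite /qpow -cexpX mulrCA. Qed.

Lemma qpow1_real (x : R) :
  qpow 1 x%:C = cos (2 * pi * x) +i* sin (2 * pi * x) :> R[i].
Proof.
rewrite /qpow /cexp mulr1 /=; simpc.
by rewrite !(mul0r, mulr0, subr0, add0r, addr0, mulr1, expR0, mul1r) /=.
Qed.

Lemma qpow1_nat n : qpow 1 n%:R = 1 :> R[i].
Proof.
rewrite -[n%:R]mulr1 qpow1X (_ : 1 = (1 : R)%:C)// qpow1_real mulr1.
by rewrite mulr_natl cos2pi sin2pi expr1n.
Qed.

(** For y = pi m / d, strictly between 0 and pi, the real part is cos(2 y) = 1 - 2 sin(y)^2 < 1. *)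
Lemma qpow1_frac_neq1 m d : (0 < m < d)%N -> qpow 1 (m%:R / d%:R) != 1 :> R[i].
Proof.
move=> /andP[m0 md]; have d0 : 0 < d%:R :> R by rewrite ltr0n (leq_trans m0)// ltnW.
have -> : m%:R / d%:R = (m%:R / d%:R : R)%:C :> R[i].
  by rewrite rmorphM fmorphV !rmorph_nat.
rewrite qpow1_real eq_complex /= negb_and; apply/orP; left.
pose y : R := pi * (m%:R / d%:R); have -> : 2 * pi * (m%:R / d%:R) = y *+ 2 :> R.
  by rewrite -mulrA mulr_natl.
have sy : 0 < sin y.
  apply: sin_gt0_pi; apply/andP; split.
    by rewrite mulr_gt0 ?pi_gt0// divr_gt0// ltr0n.
  by rewrite gtr_pMr ?pi_gt0// ltr_pdivrMr// mul1r ltr_nat.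
by rewrite cos_mulr2n; apply/eqP => ecos; have := cos2Dsin2 y; nra.
Qed.

(** If d does not divide n, then x = e^(2 pi i n / d) differs from 1, while (x - 1) times the
    geometric sum is x^d - 1 = 0. *)
Lemma sum_unity_roots d n : (0 < d)%N ->
  \sum_(b < d) qpow 1 (n%:R * b%:R / d%:R) = if (d %| n)%N then d%:R else 0 :> R[i].
Proof.
move=> d0; have dn0 : d%:R != 0 :> R[i] by rewrite pnatr_eq0 -lt0n.
have zE b : qpow 1 (n%:R * b%:R / d%:R) = qpow 1 (n%:R / d%:R) ^+ b :> R[i].
  by rewrite -qpow1X mulrA [n%:R * _]mulrC.
under eq_bigr do rewrite zE.
case: ifP => dn.
  have -> : qpow 1 (n%:R / d%:R) = 1 :> R[i].
    by rewrite -(divnK dn) natrM mulfK// qpow1_nat.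
  by under eq_bigr do rewrite expr1n; rewrite sumr_const card_ord.
set x := qpow 1 _; have x1 : x - 1 != 0.
  rewrite subr_eq0 /x (divn_eq n d) natrD natrM mulrDl mulfK// qpow1D qpow1_nat mul1r.
  by apply: qpow1_frac_neq1; rewrite ltn_mod d0 andbT lt0n; move: dn; rewrite /dvdn => ->.
apply: (mulfI x1); rewrite mulr0 -subrX1 /x -qpow1X mulrC divfK// qpow1_nat.
by rewrite subrr.
Qed.

Definition E2_partial m tau : R[i] :=
  \sum_(1 <= n < m) (sigma n)%:R * qpow 1 tau ^+ n.

Lemma E2_partialE m tau :
  E2_partial m tau = \sum_(0 <= n < m) (sigma_pos n)%:R * qpow 1 tau ^+ n.
Proof.
case: m => [|m]; first by rewrite /E2_partial !big_geq.
rewrite [RHS]big_ltn// mul0r add0r /E2_partial !big_nat.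
by apply: eq_bigr => n /andP[n0 _]; rewrite sigma_posE.
Qed.

Lemma sigma_pos_le n : (sigma_pos n <= n.+1 * n.+1)%N.
Proof.
have [->//|n0] := posnP n; rewrite sigma_posE//.
have size_div : (size (divisors n) <= n.+1)%N.
  rewrite -[leqRHS](size_iota 0); apply: uniq_leq_size; first exact: divisors_uniq.
  by move=> d; rewrite -dvdn_divisors// mem_iota add0n ltnS => /dvdn_leq; exact.
rewrite /sigma big_seq; apply: (@leq_trans (\sum_(d <- divisors n | d \in divisors n) n.+1)%N).
  by apply: leq_sum => d; rewrite -dvdn_divisors// => /dvdn_leq dn; rewrite ltnW// ltnS dn.
by rewrite -big_seq big_const_seq count_predT iter_addn_0 leq_mul2l size_div orbT.
Qed.

Lemma E2_partial_cvg tau : uhp tau -> cvgn (fun m => E2_partial m tau : C).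
Proof.
rewrite /uhp; set s := complex.Im tau => s0.
rewrite (_ : (fun m => _) = series (fun n => (sigma_pos n)%:R * qpow 1 tau ^+ n : C)); last first.
  by apply/funext => m; rewrite E2_partialE.
have pi2 := pi_ge2 R.
(* From s (n + 1) <= e^(s (n + 1)) one gets sigma(n) <= (n + 1)^2 <= (e^s / s)^2 e^(2 s n). Against
   |q|^n = e^(- 2 pi s n) this leaves ratio e^(s (2 - 2 pi)) < 1, because pi >= 2. *)
apply: (@geometric_cvg_series _ _ ((expR s / s) ^+ 2) (expR (s * (2 - 2 * pi)))).
- exact: sqr_ge0.
- by rewrite expR_ge0/= expR_lt1; nra.
move=> n; rewrite normrM normrX norm_qpow mulr1 normr_nat -real_complexX -expRM_natl.
rewrite -(@rmorph_nat _ _ (real_complex R)) -real_complexM ler_complex.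
have sn : (sigma_pos n)%:R <= (expR s / s * expR (s * n%:R)) ^+ 2 :> R.
  apply: (@le_trans _ _ (n.+1%:R ^+ 2)).
    by rewrite -natrX ler_nat expnS expn1 sigma_pos_le.
  rewrite lerXn2r ?nnegrE//; first by rewrite mulr_ge0 ?divr_ge0 ?expR_ge0 ?(ltW s0).
  rewrite mulrAC ler_pdivlMr// -expRD -[X in _ <= expR (X + _)]mulr1 -mulrDr addrC natr1.
  by rewrite mulrC (le_trans _ (expR_ge1Dx _))// lerDr.
rewrite (le_trans (ler_wpM2r (expR_ge0 _) sn))//.
have -> : expR (s * (2 - 2 * pi)) ^+ n =
    expR (s * n%:R) ^+ 2 * expR (n%:R * - (2 * pi * complex.Im tau)).
  by rewrite -!expRM_natl -expRD; congr expR; rewrite -/s; ring.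
by rewrite mulrA -[in leRHS]exprMn.
Qed.

(* Both sides are [sum_(ad = p^r) a sum_l sigma(d l) q^(a l)]. *)
Lemma E2_partial_hecke p r M tau : prime p ->
  \sum_(d <- divisors (p ^ r)) \sum_(b < d) (p ^ r %/ d)%:R / d%:R *
    E2_partial (d * (d * M)) (((p ^ r %/ d)%:R * tau + b%:R) / d%:R) =
  (sigma (p ^ r))%:R * E2_partial (p ^ r * M) tau.
Proof.
move=> pp; have n0 : (0 < p ^ r)%N by rewrite expn_gt0 prime_gt0.
set n := (p ^ r)%N in n0 *; set X := qpow 1 tau.
(* The sum over b keeps only m = d l with l < d M, and these produce the exponents k = a l < a d M =
   p^r M. Truncating at d (d M) thus gives every d the same range of exponents. *)
transitivity (\sum_(d <- divisors n) \sum_(0 <= k < (n * M)%N | (n %/ d %| k)%N)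
    ((n %/ d) * sigma_pos (d * (k %/ (n %/ d))))%:R * X ^+ k).
  rewrite big_seq [RHS]big_seq; apply: eq_bigr => d; rewrite -dvdn_divisors// => dn.
  have d0 := dvdn_gt0 n0 dn; have dn0 : d%:R != 0 :> R[i] by rewrite pnatr_eq0 -lt0n.
  set a := (n %/ d)%N; have a0 : (0 < a)%N by rewrite divn_gt0// dvdn_leq.
  have -> : (n * M = a * (d * M))%N by rewrite mulnA divnK.
  rewrite sum_dvdn_mul//.
  under eq_bigr do rewrite E2_partialE mulr_sumr.
  rewrite exchange_big/=.
  transitivity (\sum_(0 <= m < (d * (d * M))%N) a%:R / d%:R * ((sigma_pos m)%:R *
      qpow 1 (m%:R * (a%:R * tau / d%:R))) * \sum_(b < d) qpow 1 (m%:R * b%:R / d%:R)).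
    apply: eq_bigr => m _; rewrite mulr_sumr; apply: eq_bigr => b _.
    have -> : qpow 1 ((a%:R * tau + b%:R) / d%:R) ^+ m = qpow 1 (m%:R * (a%:R * tau / d%:R)) *
        qpow 1 (m%:R * b%:R / d%:R) :> R[i].
      by rewrite -qpow1X -qpow1D; congr (qpow _ _); field.
    by rewrite !mulrA.
  rewrite (bigID (fun m => (d %| m)%N))/= [X in _ + X]big1 ?addr0 => [|m]; last first.
    by rewrite sum_unity_roots// => /negPf ->; rewrite mulr0.
  rewrite sum_dvdn_mul//; apply: eq_bigr => l _.
  rewrite sum_unity_roots// dvdn_mulr// mulKn//.
  have -> : (d * l)%:R * (a%:R * tau / d%:R) = (a * l)%:R * tau.
    by rewrite !natrM; field.
  by rewrite qpow1X -/X [(a * sigma_pos _)%:R]natrM; field.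
rewrite E2_partialE mulr_sumr.
under eq_bigr do rewrite big_mkcond.
rewrite exchange_big/=; apply: eq_bigr => k _.
rewrite mulrA -natrM -(sigma_hecke r k pp) -big_mkcond natr_sum mulr_suml.
by apply: eq_bigr.
Qed.

(** Let M tend to infinity in the truncated identity. The constant term 1 contributes a / d for each
    of the d values of b, in total the sum of the a, which is sigma(p^r). *)
Lemma E2_hecke p r tau : prime p -> uhp tau ->
  \sum_(d <- divisors (p ^ r)) \sum_(b < d) (p ^ r %/ d)%:R / d%:R *
    E2 (((p ^ r %/ d)%:R * tau + b%:R) / d%:R) =
  (sigma (p ^ r))%:R * E2 tau.
Proof.
move=> pp utau; have n0 : (0 < p ^ r)%N by rewrite expn_gt0 prime_gt0.
pose L z : R[i] := limn (fun m => E2_partial m z : C).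
have E2E z : E2 z = 1 - 24 * L z by [].
have Lcvg z K : uhp z -> (0 < K)%N -> (fun M => E2_partial (K * M) z : C) @ \oo --> (L z : C).
  by move=> uz K0; exact: (@cvg_mul_subseq _ _ _ _ K0 (E2_partial_cvg uz)).
have LE : \sum_(d <- divisors (p ^ r)) \sum_(b < d) (p ^ r %/ d)%:R / d%:R *
    L (((p ^ r %/ d)%:R * tau + b%:R) / d%:R) = (sigma (p ^ r))%:R * L tau.
  have lhs : (fun M => \sum_(d <- divisors (p ^ r)) \sum_(b < d) (p ^ r %/ d)%:R / d%:R *
    E2_partial (d * (d * M)) (((p ^ r %/ d)%:R * tau + b%:R) / d%:R) : C) @ \oo -->
    (\sum_(d <- divisors (p ^ r)) \sum_(b < d) (p ^ r %/ d)%:R / d%:R *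
      L (((p ^ r %/ d)%:R * tau + b%:R) / d%:R) : C).
    apply: cvg_bigsum => d; rewrite -dvdn_divisors// => dn.
    have d0 := dvdn_gt0 n0 dn.
    apply: cvg_bigsum => b _; apply: cvg_mull.
    under eq_fun do rewrite mulnA.
    by apply: Lcvg; rewrite ?muln_gt0 ?d0//; apply: uhp_affine; rewrite // divn_gt0// dvdn_leq.
  apply: regular_cvg_unique lhs _.
  under eq_fun do rewrite E2_partial_hecke//.
  by apply: cvg_mull; exact: Lcvg.
rewrite E2E mulrBr mulr1 mulrCA -LE mulr_sumr -(sigma_div n0) natr_sum -sumrB.
rewrite big_seq [RHS]big_seq; apply: eq_bigr => d; rewrite -dvdn_divisors// => dn.
have d0 := dvdn_gt0 n0 dn; have dn0 : d%:R != 0 :> R[i] by rewrite pnatr_eq0 -lt0n.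
transitivity (\sum_(b < d) (p ^ r %/ d)%:R / d%:R - 24 * (\sum_(b < d) (p ^ r %/ d)%:R / d%:R *
    L (((p ^ r %/ d)%:R * tau + b%:R) / d%:R))).
  by rewrite mulr_sumr -sumrB; apply: eq_bigr => b _; rewrite E2E mulrBr mulr1 mulrCA.
by rewrite sumr_const card_ord -[_ *+ d]mulr_natr divfK.
Qed.

End EisensteinTwo.

(** * Hecke operators of weight 2 *)

Section HeckeOperators.
Context {R : realType}.
Local Notation C := (R[i]^o).
Implicit Types (f : wform R) (F G : R[i] -> R[i]) (P Q : R[i] -> Prop) (z tau : R[i]).

Definition affine (a b d : nat) z : R[i] := (a%:R * z + b%:R) / d%:R.

Lemma slash_upper k F a b d z : slash k F (upper_mx a b d) z =
  ((a * d)%:R `^ (k%:~R / 2) : R)%:C * d%:R ^ (- k) * F (affine a b d z).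
Proof.
have det_upper : \det (upper_mx a b d) = (a * d)%:Z.
  rewrite (expand_det_row _ ord0) big_ord_recl big_ord1 /cofactor !det_mx11 !mxE /=.
  by rewrite !mulr0 addr0 expr0 mul1r PoszM.
rewrite /slash /moebius /affine det_upper !mxE /=.
by rewrite mul0r add0r.
Qed.

Lemma add_hecke2E n F z : (0 < n)%N -> add_hecke2 n F z =
  \sum_(d <- divisors n) \sum_(b < d) (n %/ d)%:R / d%:R * F (affine (n %/ d) b d z).
Proof.
move=> n0; rewrite /add_hecke2 big_seq [RHS]big_seq; apply: eq_bigr => d.
rewrite -dvdn_divisors// => dn; apply: eq_bigr => b _.
have d0 : d%:R != 0 :> R[i] by rewrite pnatr_eq0 -lt0n (dvdn_gt0 n0 dn).
rewrite slash_upper divff ?pnatr_eq0// powRr1// rmorph_nat natrM.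
by congr (_ * _); rewrite -[d%:R ^ _]/(d%:R ^+ 2)^-1; field.
Qed.

Lemma affine_comp a b d a' b' d' z : (0 < d)%N -> (0 < d')%N ->
  affine a' b' d' (affine a b d z) = affine (a' * a) (a' * b + b' * d) (d' * d) z.
Proof.
move=> d0 d0'; rewrite /affine natrD !natrM; field.
by rewrite !pnatr_eq0 -!lt0n d0 d0'.
Qed.

(** P holds off a discrete closed subset of the upper half-plane: the analogue of [mero_eq] for an
    arbitrary property. *)
Definition near_uhp P : Prop :=
  forall z0, uhp z0 -> \forall z \near (z0 : C)^', P z.

Lemma near_uhp_imp P Q : (forall z, P z -> Q z) -> near_uhp P -> near_uhp Q.
Proof. by move=> PQ Pn z0 uz0; apply: filterS (Pn _ uz0). Qed.

Lemma near_uhpI P Q : near_uhp P -> near_uhp Q -> near_uhp (fun z => P z /\ Q z).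
Proof. by move=> Pn Qn z0 uz0; apply: filterI; [exact: Pn|exact: Qn]. Qed.

Lemma near_uhp_uhp : near_uhp (fun z => uhp z).
Proof.
move=> z0 uz0; apply/dnear_complexP; exists (complex.Im z0) => // z _ /Im_sub_lt.
by rewrite subrr.
Qed.

Lemma near_uhp_seq (I : eqType) (s : seq I) (P : I -> R[i] -> Prop) :
  (forall i, i \in s -> near_uhp (P i)) ->
  near_uhp (fun z => forall i, i \in s -> P i z).
Proof.
elim: s => [_|i s IH Ps]; first by move=> z0 _; exact: filterE.
apply: near_uhp_imp (near_uhpI (Ps i (mem_head _ _)) (IH _)); last first.
  by move=> j js; apply: Ps; rewrite in_cons js orbT.
by move=> z [Pi Pj] j; rewrite in_cons => /orP[/eqP->|/Pj].
Qed.

Lemma near_uhp_near P : near_uhp P -> near_uhp (fun z => \forall w \near (z : C), P w).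
Proof. by move=> Pn z0 uz0; apply: dnear_near; exact: Pn. Qed.

(** The map is a similarity of ratio q = a / d preserving the upper half-plane, so a punctured disc
    of radius r pulls back to one of radius r / q. *)
Lemma near_uhp_affine P a b d : (0 < a)%N -> (0 < d)%N ->
  near_uhp P -> near_uhp (fun z => P (affine a b d z)).
Proof.
move=> a0 d0 Pn z0 uz0.
have /dnear_complexP[r r0 rP] := Pn _ (uhp_affine b a0 d0 uz0).
pose q : R := a%:R / d%:R; have q0 : 0 < q by rewrite divr_gt0// ltr0n.
have qC : q%:C = a%:R / d%:R :> R[i] by rewrite rmorphM fmorphV !rmorph_nat.
have subE z w : affine a b d z - affine a b d w = q%:C * (z - w).
  by rewrite qC /affine; ring.
apply/dnear_complexP; exists (r / q); first exact: divr_gt0.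
move=> z zz0 zr; apply: rP.
  by rewrite -subr_eq0 subE mulf_neq0 ?subr_eq0// -normr_gt0 normc_real ltr_complex normr_gt0 gt_eqF.
rewrite subE normrM normc_real (gtr0_norm q0).
have -> : r%:C = q%:C * (r / q)%:C :> R[i].
  by rewrite -real_complexM mulrCA divff ?mulr1// gt_eqF.
have qC0 : 0 < q%:C :> R[i] by rewrite ltr_complex.
by rewrite (ltr_pM2l qC0).
Qed.

Lemma near_uhp_cosets n P : (0 < n)%N -> near_uhp P ->
  near_uhp (fun z => forall d, d \in divisors n -> forall b : 'I_d, P (affine (n %/ d) b d z)).
Proof.
move=> n0 Pn; apply: near_uhp_seq => d; rewrite -dvdn_divisors// => dn.
have d0 := dvdn_gt0 n0 dn.
apply: (@near_uhp_imp (fun z => forall b : 'I_d, b \in enum 'I_d -> P (affine (n %/ d) b d z))).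
  by move=> z zP b; apply: zP; rewrite mem_enum.
apply: near_uhp_seq => b _; apply: near_uhp_affine => //.
by rewrite divn_gt0// dvdn_leq.
Qed.

Lemma near_uhp_add_hecke2 n F G : (0 < n)%N -> near_uhp (fun z => F z = G z) ->
  near_uhp (fun z => add_hecke2 n F z = add_hecke2 n G z).
Proof.
move=> n0 FG; apply: near_uhp_imp (near_uhp_cosets n0 FG) => z zFG.
rewrite !add_hecke2E// big_seq [RHS]big_seq; apply: eq_bigr => d dn.
by apply: eq_bigr => b _; rewrite zFG.
Qed.

Lemma modn_mulI u d b b' : coprime u d -> (b < d)%N -> (b' < d)%N ->
  (u * b = u * b' %[mod d])%N -> b = b'.
Proof.
move=> cud; wlog bb : b b' / (b <= b')%N => [IH bd bd' E|bd bd' /eqP].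
  by have [/IH->//|/ltnW/IH->//] := leqP b b'.
rewrite eq_sym eqn_mod_dvd ?leq_mul2l ?bb ?orbT// -mulnBr Gauss_dvdr 1?coprime_sym//.
move=> db; apply/eqP; rewrite eqn_leq bb /= -subn_eq0.
have [//|b0] := posnP (b' - b); move: (dvdn_leq b0 db).
by rewrite leqNgt (leq_ltn_trans (leq_subr _ _) bd').
Qed.

(** Each residue modulo e d is u b + c d for exactly one pair: modulo d it determines b, as u is
    invertible there, and then c. Counting turns injectivity into bijectivity. *)
Lemma sum_ord_coprime (V : nmodType) u d e (H : nat -> V) : (0 < d)%N -> (0 < e)%N ->
  coprime u d ->
  \sum_(b < d) \sum_(c < e) H ((u * b + c * d) %% (e * d))%N = \sum_(B < e * d) H B.
Proof.
move=> d0 e0 cud; have ed0 : (0 < e * d)%N by rewrite muln_gt0 e0.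
pose h (bc : 'I_d * 'I_e) : 'I_(e * d) := Ordinal (ltn_pmod (u * bc.1 + bc.2 * d) ed0).
have hI : injective h.
  move=> [b c] [b' c'] /(congr1 val) /= E.
  have Ed : (u * b + c * d = u * b' + c' * d %[mod d])%N.
    by rewrite -(modn_dvdm (u * b + c * d) (dvdn_mull e (dvdnn d))) E modn_dvdm// dvdn_mull.
  have bb' : b = b'.
    move: Ed; rewrite ![(u * _ + _)%N]addnC !modnMDl => Ed.
    exact/val_inj/(modn_mulI cud (ltn_ord b) (ltn_ord b')).
  congr (_, _) => //; apply/val_inj => /=; move: E; rewrite bb' => /eqP.
  by rewrite eqn_modDl -!muln_modl// eqn_pmul2r// !modn_small// => /eqP.
have hb : bijective h.
  by apply: inj_card_bij => //; rewrite card_prod !card_ord mulnC.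
rewrite pair_bigA /= [RHS](reindex h); last exact: onW_bij.
by apply: eq_bigr.
Qed.

Lemma near_uhp_shift F : near_uhp (fun z => F (z + 1) = F z) ->
  forall j, near_uhp (fun z => F (z + j%:R) = F z).
Proof.
move=> Fper; elim=> [|j IH]; first by move=> z0 _; apply: filterE => z; rewrite addr0.
have := near_uhp_affine j (ltn0Sn 0) (ltn0Sn 0) Fper.
move/near_uhpI => /(_ _ IH); apply: near_uhp_imp => z [].
by rewrite /affine !mulr1n divr1 mul1r -addrA natr1 => -> ->.
Qed.

(** Composing the representatives (m / d, b; 0, d) and (n / e, c; 0, e) gives upper right entry (n /
    e) b + c d. Since n / e is prime to d, these entries run once through the residues modulo e d,
    and periodicity of F replaces each entry by its residue. *)
Lemma add_hecke2_comp m n F : (0 < m)%N -> (0 < n)%N -> coprime m n ->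
  near_uhp (fun z => F (z + 1) = F z) ->
  near_uhp (fun z => add_hecke2 m (add_hecke2 n F) z = add_hecke2 (m * n) F z).
Proof.
move=> m0 n0 cmn Fper.
have mn0 : (0 < m * n)%N by rewrite muln_gt0 m0.
(* Reducing the entry B modulo e d translates the argument by an integer, and F is invariant under
   that only off a discrete set. The finitely many instances are collected so that one z serves them
   all. *)
pose Per d e b c z := let B := ((n %/ e) * b + c * d)%N in
  F (affine ((n %/ e) * (m %/ d)) B (e * d) z) =
  F (affine ((n %/ e) * (m %/ d)) (B %% (e * d)) (e * d) z).
have nearPer : near_uhp (fun z => forall d, d \in divisors m ->
    forall e, e \in divisors n -> forall b, b \in enum 'I_d ->
    forall c, c \in enum 'I_e -> Per d e b c z).
  apply: near_uhp_seq => d; rewrite -dvdn_divisors// => dm.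
  have d0 := dvdn_gt0 m0 dm.
  apply: near_uhp_seq => e; rewrite -dvdn_divisors// => en.
  have e0 := dvdn_gt0 n0 en.
  apply: near_uhp_seq => b _; apply: near_uhp_seq => c _.
  have a0 : (0 < (n %/ e) * (m %/ d))%N.
    by rewrite muln_gt0 !divn_gt0// (dvdn_leq m0 dm) (dvdn_leq n0 en).
  have ed0 : (0 < e * d)%N by rewrite muln_gt0 e0.
  rewrite /Per /=; move: ((n %/ e) * b + c * d)%N (divn_eq ((n %/ e) * b + c * d) (e * d)) => B.
  move: (B %/ (e * d))%N (B %% (e * d))%N => q s BE.
  have := near_uhp_affine s a0 ed0 (P := fun z => F (z + q%:R) = F z) (near_uhp_shift Fper q).
  apply: near_uhp_imp => z <-; congr (F _).
  rewrite /affine BE natrD natrM; field.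
  by rewrite !pnatr_eq0 -!lt0n ?e0 ?d0 ?ed0.
apply: near_uhp_imp nearPer => z zPer.
rewrite !add_hecke2E// (perm_big _ (perm_divisors_coprime cmn m0 n0)) big_allpairs_dep/=.
rewrite big_seq [RHS]big_seq; apply: eq_bigr => d dm.
have dm' : (d %| m)%N by rewrite dvdn_divisors.
have d0 := dvdn_gt0 m0 dm'.
under eq_bigr do rewrite add_hecke2E// mulr_sumr.
rewrite exchange_big/= big_seq [RHS]big_seq; apply: eq_bigr => e en.
have en' : (e %| n)%N by rewrite dvdn_divisors.
have e0 := dvdn_gt0 n0 en'.
have aE : ((m * n) %/ (d * e) = (n %/ e) * (m %/ d))%N.
  have de0 : (0 < d * e)%N by rewrite muln_gt0 d0.
  rewrite -[RHS](mulnK _ de0); congr (_ %/ _)%N.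
  by rewrite [(n %/ e * _)%N]mulnC mulnACA (divnK dm') (divnK en').
rewrite aE [(d * e)%N]mulnC -[RHS]mulr_sumr.
have cud : coprime (n %/ e) d.
  rewrite coprime_sym; apply: coprime_dvdl dm' (coprime_dvdr _ cmn).
  by apply/dvdnP; exists e; rewrite mulnC divnK.
rewrite -(sum_ord_coprime (fun B => F (affine ((n %/ e) * (m %/ d)) B (e * d) z)) d0 e0 cud).
rewrite mulr_sumr; apply: eq_bigr => b _.
rewrite !mulr_sumr; apply: eq_bigr => c _.
rewrite affine_comp// mulrA -(zPer d dm e en b _ c _) ?mem_enum//.
by congr (_ * _); rewrite !natrM; field; rewrite !pnatr_eq0 -!lt0n d0.
Qed.

End HeckeOperators.

(** * Logarithmic derivatives *)

Section LogarithmicDerivative.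
Context {R : realType}.
Local Notation C := (R[i]^o).
Implicit Types (f : wform R) (F : R[i] -> R[i]) (z tau : R[i]).

Definition regular_at F z := derivable (F : C -> C) (z : C) 1 /\ F z != 0.

Lemma E2_shift z : E2 (z + 1) = E2 z.
Proof. by rewrite /E2 qpow1D (qpow1_nat 1) mulr1. Qed.

(** Nonzero constants cancel in the logarithmic derivative, and the factor a / d from the chain rule
    is exactly the weight 2 factor p^r / d^2. Regularity of the new form is what lets the operators
    be iterated. *)
Lemma mult_hecke_pp_regular p r f z : prime p ->
    (forall d, d \in divisors (p ^ r) -> forall b : 'I_d,
       regular_at f (affine (p ^ r %/ d) b d z)) ->
  regular_at (mult_hecke_pp p r f) z /\
  theta (mult_hecke_pp p r f) z / mult_hecke_pp p r f z =
  \sum_(d <- divisors (p ^ r)) \sum_(b < d) (p ^ r %/ d)%:R / d%:R *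
    (theta f (affine (p ^ r %/ d) b d z) / f (affine (p ^ r %/ d) b d z)).
Proof.
move=> pp freg; have n0 : (0 < p ^ r)%N by rewrite expn_gt0 prime_gt0.
set n := (p ^ r)%N in freg n0 *.
(* The matrices are upper triangular, so their slash factor depends neither on tau nor on b. *)
pose k d : R[i] := (((n %/ d * d)%N%:R `^ ((wt f)%:~R / 2) : R)%:C * d%:R ^ (- wt f)).
pose g d (b : 'I_d) w : R[i] := k d * f (affine (n %/ d) b d w).
pose K : R[i] := lead_normalizer (fun tau => (hecke_const R p r (wt f))%:C *
    \prod_(d <- divisors n) \prod_(b < d)
       slash (wt f) f (upper_mx (n %/ d) b d) tau) * (hecke_const R p r (wt f))%:C.
have ppE w : mult_hecke_pp p r f w = K * \prod_(d <- divisors n) \prod_(b < d) g d b w.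
  rewrite /= /K -!mulrA; congr (_ * (_ * _)); apply: eq_bigr => d _.
  by apply: eq_bigr => b _; rewrite slash_upper.
have K0 : K != 0.
  rewrite mulf_neq0 ?lead_normalizer_neq0// -normr_gt0 normc_real ltr_complex normr_gt0.
  by rewrite gt_eqF// powR_gt0// ltr0n prime_gt0.
have dn0 d : d \in divisors n -> (0 < d)%N by rewrite -dvdn_divisors// => /(dvdn_gt0 n0).
have k0 d : d \in divisors n -> k d != 0.
  move=> dn; have d0 := dn0 _ dn; rewrite mulf_neq0//.
    rewrite -normr_gt0 normc_real ltr_complex normr_gt0 gt_eqF// powR_gt0// ltr0n.
    by rewrite divnK// dvdn_divisors.
  by rewrite expfz_neq0// pnatr_eq0 -lt0n.
have affE a b d w : (affine a b d w : R[i]) = a%:R / d%:R * w + b%:R / d%:R.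
  by rewrite /affine; ring.
have fder d (b : 'I_d) : d \in divisors n ->
    derivable (fun w : C => f (affine (n %/ d) b d w) : C) (z : C) 1 /\
    derive1 (fun w : C => f (affine (n %/ d) b d w) : C) (z : C) =
      (n %/ d)%:R / d%:R * (derive1 (f : C -> C) (affine (n %/ d) b d z : C) : R[i]) :> R[i].
  move=> dn; have [fd _] := freg d dn b; rewrite affE in fd *.
  split; first by under eq_fun do rewrite affE; exact: derivable_affine fd.
  by under eq_fun do rewrite affE; exact: derive1_affine fd.
have gder d (b : 'I_d) : d \in divisors n ->
    derivable (g d b : C -> C) (z : C) 1 /\ (derive1 (g d b : C -> C) (z : C) : R[i]) / g d b z =
      (n %/ d)%:R / d%:R * ((derive1 (f : C -> C) (affine (n %/ d) b d z : C) : R[i]) /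
        f (affine (n %/ d) b d z)).
  move=> dn; have [fd fE] := fder d b dn.
  split; first exact: (derivable_mul (@derivable_const _ (k d) z) fd).
  rewrite /g (derive1_mull (k d) fd) fE; have [_ f0] := freg d dn b.
  by rewrite -mulf_div (divff (k0 _ dn)) mul1r mulrA.
have g0 d (b : 'I_d) : d \in divisors n -> g d b z != 0.
  by move=> dn; rewrite mulf_neq0 ?k0//; have [] := freg d dn b.
have Gder d : d \in divisors n -> derivable (fun w : C => \prod_(b < d) g d b w : C) (z : C) 1.
  by move=> dn; apply: derivable_prod => b _; have [] := gder d b dn.
have G0 d : d \in divisors n -> \prod_(b < d) g d b z != 0.
  by move=> dn; apply/prodf_neq0 => b _; exact: g0.
have Pder : derivable (fun w : C => \prod_(d <- divisors n) \prod_(b < d) g d b w : C) (z : C) 1.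
  exact: (derivable_prod Gder).
have ppfun : (mult_hecke_pp p r f : R[i] -> R[i]) =
    (fun w => K * \prod_(d <- divisors n) \prod_(b < d) g d b w).
  by apply/funext.
split.
  rewrite /regular_at ppfun; split.
    exact: (derivable_mul (@derivable_const _ K z) Pder).
  rewrite mulf_neq0// prodf_seq_neq0; apply/allP => d dn /=; exact: G0.
pose D : R[i] := derive1 (fun w : C => \prod_(d <- divisors n) \prod_(b < d) g d b w : C) (z : C).
have thetaE : theta (mult_hecke_pp p r f) z = (2 * pi)%:C^-1 / 'i * (K * D).
  by rewrite /theta ppfun (derive1_mull K Pder).
have LD : D / \prod_(d <- divisors n) \prod_(b < d) g d b z =
    \sum_(d <- divisors n)
      (derive1 (fun w : C => \prod_(b < d) g d b w : C) (z : C) : R[i]) / \prod_(b < d) g d b z.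
  exact: (logderive_prod Gder G0).
have cancelK (x y w : R[i]) : x * (K * y) / (K * w) = x * (y / w).
  by rewrite -[LHS]mulrA -mulf_div (divff K0) mul1r.
rewrite thetaE.
rewrite (ppE z).
rewrite cancelK.
rewrite LD.
rewrite mulr_sumr.
rewrite big_seq [RHS]big_seq; apply: eq_bigr => d dn.
have Ld : (derive1 (fun w : C => \prod_(b < d) g d b w : C) (z : C) : R[i]) / \prod_(b < d) g d b z =
    \sum_(b < d) (derive1 (g d b : C -> C) (z : C) : R[i]) / g d b z.
  by apply: logderive_prod => b _; [have [] := gder d b dn|exact: g0].
rewrite Ld mulr_sumr; apply: eq_bigr => b _; have [_ ->] := gder d b dn.
by rewrite /theta mulrCA !mulrA.
Qed.

Lemma Dlog_mult_hecke_pp p r f z : prime p -> uhp z ->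
    (forall d, d \in divisors (p ^ r) -> forall b : 'I_d,
       regular_at f (affine (p ^ r %/ d) b d z)) ->
  Dlog (mult_hecke_pp p r f) z = add_hecke2 (p ^ r) (Dlog f) z.
Proof.
move=> pp uz freg; have n0 : (0 < p ^ r)%N by rewrite expn_gt0 prime_gt0.
have [_ thetaE] := mult_hecke_pp_regular pp freg.
have wtE : (wt (mult_hecke_pp p r f))%:~R = (wt f)%:~R * (sigma (p ^ r))%:R :> R[i].
  exact: intrM.
rewrite [LHS]/Dlog.
rewrite thetaE.
rewrite wtE.
rewrite -[(wt f)%:~R * _ * E2 z]mulrA.
(* The factor sigma(p^r) of the new weight, together with E_2, becomes the sum E_2 | T_2(p^r); both
   sides then agree term by term. *)
rewrite -(E2_hecke r pp uz).
rewrite (add_hecke2E _ _ n0).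
rewrite mulr_sumr mulr_suml -sumrB; apply: eq_bigr => d _.
rewrite mulr_sumr mulr_suml -sumrB; apply: eq_bigr => b _.
rewrite /Dlog -/(affine (p ^ r %/ d) b d z).
move: (affine (p ^ r %/ d) b d z) => w.
by move: (theta f w / f w) (E2 w) (_ / d%:R) => x y t; ring.
Qed.

(** The constant chi cancels in the logarithmic derivative and E_2 has period 1. Differentiating the
    relation requires it on a neighbourhood of z, whence [near_uhp_near]. *)
Lemma Dlog_shift (chi : R[i]) f : chi != 0 -> near_uhp (regular_at f) ->
  near_uhp (fun z => f (z + 1) = chi * f z) ->
  near_uhp (fun z => Dlog f (z + 1) = Dlog f z).
Proof.
move=> chi0 freg fper; apply: near_uhp_imp
  (near_uhpI (near_uhp_near fper) (near_uhpI freg (near_uhp_affine 1 (ltn0Sn 0) (ltn0Sn 0) freg))).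
move=> z [zper [[fd f0]]]; rewrite /affine divr1 mul1r => -[fd1 _].
have der : derive1 (f : C -> C) (z + 1 : C) = chi * (derive1 (f : C -> C) (z : C) : R[i]) :> R[i].
  rewrite -(derive1_mull chi fd) -(derive1_near_eq zper).
  under eq_fun do rewrite -[X in X + 1]mul1r.
  by rewrite derive1_affine ?mul1r//; exact: fd1.
have fz : f (z + 1) = chi * f z by exact: nbhs_singleton zper.
have LE : theta f (z + 1) / f (z + 1) = theta f z / f z.
  rewrite fz /theta der.
  move: (derive1 (f : C -> C) (z : C)) ((2 * pi)%:C^-1 / 'i) => D t.
  by rewrite mulrCA -mulf_div (divff chi0) mul1r.
exact: (congr2 (fun x y => x - (wt f)%:~R * y / 12) LE (E2_shift z)).
Qed.

Lemma regular_near F : (forall tau, uhp tau -> meromorphic_at F tau) ->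
  near_uhp (fun z => F z != 0) -> near_uhp (regular_at F).
Proof.
move=> merF F0; apply: near_uhpI F0 => z0 uz0.
by apply: meromorphic_derivable; exact: merF.
Qed.

Lemma add_hecke2_1 F z : add_hecke2 1 F z = F z.
Proof.
rewrite add_hecke2E// (_ : divisors 1 = [:: 1%N])// big_seq1 big_ord1 /affine.
by rewrite divnn /= mulr1n !divr1 !mul1r addr0.
Qed.

(** The induction removes the last prime power, the outermost operator of the fold: [Dlog] of the
    new form is T_2(p^r) applied to ([Dlog f]) | T_2(m). Distinctness of the primes gives
    coprimality of p^r and m, so the two additive operators merge. *)
Lemma Dlog_foldl (s : seq (nat * nat)) f :
    near_uhp (regular_at f) -> near_uhp (fun z => Dlog f (z + 1) = Dlog f z) ->
    (forall pr, pr \in s -> prime pr.1) -> uniq (unzip1 s) ->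
  near_uhp (regular_at (foldl (fun g pr => mult_hecke_pp pr.1 pr.2 g) f s)) /\
  near_uhp (fun z => Dlog (foldl (fun g pr => mult_hecke_pp pr.1 pr.2 g) f s) z =
    add_hecke2 (\prod_(pr <- s) pr.1 ^ pr.2) (Dlog f) z).
Proof.
move=> freg fper; elim/last_ind: s => [_ _|s [p r] IH spr].
  split=> //; rewrite big_nil => z0 _; apply: filterE => z /=.
  by rewrite add_hecke2_1.
rewrite /unzip1 map_rcons rcons_uniq => /andP[/= ps us].
have sprime pr : pr \in s -> prime pr.1.
  by move=> prs; apply: spr; rewrite mem_rcons in_cons prs orbT.
have pp : prime p by apply: (spr (p, r)); rewrite mem_rcons mem_head.
have [greg gD] := IH sprime us; rewrite foldl_rcons /=.
set g := foldl _ f s in greg gD *; rewrite -cats1 big_cat big_seq1 /=.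
have n0 : (0 < p ^ r)%N by rewrite expn_gt0 prime_gt0.
set m := (\prod_(pr <- s) pr.1 ^ pr.2)%N in gD *.
have m0 : (0 < m)%N.
  rewrite /m big_seq prodn_cond_gt0// => pr /sprime pr_prime.
  by rewrite expn_gt0 prime_gt0.
have cpm : coprime (p ^ r) m.
  apply: coprimeXl; rewrite /m big_seq; elim/big_ind: _ => [|x y cx cy|[p' r'] prs].
  - exact: coprimen1.
  - by rewrite coprimeMr cx.
  apply: coprimeXr; rewrite prime_coprime// dvdn_prime2 ?(sprime _ prs)//=.
  by apply: contraNneq ps => ->; apply/mapP; exists (p', r').
have reg := near_uhp_cosets n0 greg.
split; first by apply: near_uhp_imp reg => z /(mult_hecke_pp_regular pp)[].
apply: near_uhp_imp (near_uhpI near_uhp_uhp (near_uhpI reg (near_uhpI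
  (near_uhp_add_hecke2 n0 gD) (add_hecke2_comp n0 m0 cpm fper)))).
move=> z [uz [zreg [zg zf]]].
by rewrite [LHS](Dlog_mult_hecke_pp pp uz zreg) zg zf [(m * _)%N]mulnC.
Qed.

End LogarithmicDerivative.

Theorem theorem1p18 (R : realType) (n N : nat) (hn : (0 < n)%N) (hN : (0 < N)%N)
    (hnN : coprime n N) (f : wform R) (hf : mult_form N f) :
  mero_eq [set tau : R[i] | uhp tau]
    (Dlog (mult_hecke n f)) (add_hecke2 n (Dlog f)).
Proof.
have [merf [chi chiP] _ [h [c [c01 fc]]]] := hf.
have c0 : (c 0%N)%:~R != 0 :> R[i] by rewrite c01 oner_neq0.
have freg := regular_near merf (meromorphic_neq0 merf fc c0).
(* The translation z -> z + 1 has automorphy factor 1, so modularity under it reads f(z + 1) =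
   chi(T) f(z), and |chi(T)| = 1 makes the constant nonzero. *)
pose T : 'M[int]_2 := upper_mx 1 1 1.
have GT : Gamma0 N T.
  rewrite /Gamma0 (expand_det_row _ ord0) big_ord_recl big_ord1 /cofactor !det_mx11 !mxE /=.
  by rewrite dvdz0.
have [chi1 fT] := chiP T GT.
have chi0 : chi T != 0 by rewrite -normr_gt0 chi1.
have fper : near_uhp (fun z => f (z + 1) = chi T * f z).
  apply: near_uhp_imp fT => z; rewrite /moebius !mxE /= mul0r add0r divr1 mul1r.
  by rewrite exp1rz mulr1.
have [||_ DE] := Dlog_foldl freg (Dlog_shift chi0 freg fper) (s := prime_decomp n).
- by move=> [p r] /mem_prime_decomp[].
- exact: primes_uniq.
by rewrite -prod_prime_decomp in DE.
Qed.
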